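(* Let $K$ be a field, let $S'=K[x_1,\dots,x_n]$ and $S=S'[x]=K[x_1,\dots,x_n,x]$ be polynomial rings, and let $I\subset S'$ be a squarefree monomial ideal all of whose squarefree powers $I^{[k]}$, $1\le k\le\nu(I)$, are componentwise linear. Let $J=(I,x)\subset S$ and $d_k=\mathrm{indeg}(I^{[k]})$ for $1\le k\le\nu(I)$. Furthermore, set $g_I(0)=g_I(\nu(I)+1)=+\infty$ and $d_0=0$. Then $\nu(J)=\nu(I)+1$, and for all $1\le k\le\nu(J)$, $$g_J(k)=\min\{g_I(k)+d_k-d_{k-1}-1,\ g_I(k-1)\},$$ where for $k=\nu(I)+1$ the first term in the minimum is understood to be $+\infty$.
   Context: All squarefree monomial ideals are nonzero and proper. For a squarefree monomial ideal $I$ in a polynomial ring $T$ over $K$, the $k$th squarefree power $I^{[k]}$ is the monomial ideal of $T$ generated by the squarefree monomials belonging to $I^k$. The monomial grade $\nu(I)$ is the biggest length of a monomial regular sequence contained in $I$; equivalently $I^{[k]}\neq(0)$ if and only if $k\le\nu(I)$. For $1\le k\le \nu(I)$, $\mathrm{indeg}(I^{[k]})$ is the minimum degree of a monomial generator of $I^{[k]}$, and the normalized depth function of $I$ is $g_I(k)=\mathrm{depth}(T/I^{[k]})-(\mathrm{indeg}(I^{[k]})-1)$ for $1\le k\le\nu(I)$. By convention the ambient polynomial ring $T$ is the smallest polynomial ring over $K$ containing the minimal monomial generators of $I$ (every variable divides some minimal generator); here $g_I$ is computed in $S'$ and $g_J$ in $S$. A homogeneous ideal $L$ is componentwise linear if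 for every $j$ the ideal generated by all homogeneous elements of degree $j$ in $L$ has a linear resolution. *)

(* Defs.v *)
From mathcomp Require Import all_boot all_order all_algebra.
From mathcomp Require Export mpoly.
                                                                     
From mathcomp Require Export -(notations) constructive_ereal.
From Stdlib Require Import ClassicalEpsilon.

Set Implicit Arguments.
Unset Strict Implicit.
Unset Printing Implicit Defensive.

Import Order.TTheory GRing.Theory Num.Theory.
Local Open Scope ring_scope.

                                                                           
                    
Definition nat_max (P : nat -> Prop) : nat :=
  epsilon (inhabits 0%N) (fun v => P v /\ forall m, P m -> (m <= v)%N).

Definition nat_min (P : nat -> Prop) : nat :=
  epsilon (inhabits 0%N) (fun v => P v /\ forall m, P m -> (v <= m)%N).

Section Ideals.
Variables (K : fieldType) (n : nat).
Local Notation T := {mpoly K[n]}.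
Implicit Types (A L : T -> Prop) (s : seq T) (m : 'X_{1..n}).

                                                                           
                                       
Definition ideal_gen A : T -> Prop := fun f =>
  exists s : seq (T * T),
    (forall p, p \in s -> A p.2) /\ f = \sum_(p <- s) p.1 * p.2.

Definition ideal_mul (L1 L2 : T -> Prop) : T -> Prop :=
  ideal_gen (fun h => exists f g, [/\ L1 f, L2 g & h = f * g]).

Definition ideal_pow L (k : nat) : T -> Prop :=
  iter k (ideal_mul L) (fun _ => True).

Definition sqfree_mon m : Prop := forall i : 'I_n, (m i <= 1)%N.

Definition sqfree_monomial_ideal L : Prop :=
  [/\ exists A : 'X_{1..n} -> Prop,
        (forall m, A m -> sqfree_mon m) /\
        (forall f, L f <-> ideal_gen (fun g => exists2 m, A m & g = 'X_[m]) f),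
      exists2 f, L f & f != 0
    & ~ L 1].

Definition sqfree_pow L (k : nat) : T -> Prop :=
  ideal_gen (fun f => exists m,
    [/\ sqfree_mon m, ideal_pow L k 'X_[m] & f = 'X_[m]]).

Definition ideal_adjoin L s : T -> Prop :=
  ideal_gen (fun f => L f \/ f \in s).

                                     
Definition regular_seq L s : Prop :=
  ~ ideal_adjoin L s 1 /\
  forall (i : nat) (f : T), (i < size s)%N ->
    ideal_adjoin L (take i s) (s`_i * f) -> ideal_adjoin L (take i s) f.

Definition monomial_grade L : nat :=
  nat_max (fun v => exists ms : seq 'X_{1..n},
    let s := [seq 'X_[m] | m <- ms] in
    [/\ size ms = v, forall f, f \in s -> L f
      & regular_seq (fun f => f = 0) s]).

                                                                              
                                           
Definition depth_quot L : nat :=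
  nat_max (fun v => exists s : seq T,
    [/\ size s = v, forall f, f \in s -> f@_0%MM = 0 & regular_seq L s]).

                                                                 
Definition min_generator L m : Prop :=
  L 'X_[m] /\ forall m', L 'X_[m'] -> (m' <= m)%MM -> m' = m.

Definition indeg L : nat :=
  nat_min (fun d => exists2 m, min_generator L m & mdeg m = d).

                           
                                                                         
                                                                             
                                                                               
                                                             
Definition linear_resolution L : Prop :=
  exists (d s : nat) (b : nat -> nat) (e : 'cV[T]_(b 0%N))
         (phi : forall i, 'M[T]_(b i.+1, b i)),
    (forall i, (s < i)%N -> b i = 0%N) /\
    (forall r, e r 0 \is d.-homog) /\
    (forall i r c, phi i r c \is 1.-homog) /\
    (forall f, L f <-> exists v : 'rV[T]_(b 0%N), f = (v *m e) 0 0) /\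
    (forall v : 'rV[T]_(b 0%N), v *m e = 0 <-> exists w, v = w *m phi 0%N) /\
    (forall i (v : 'rV[T]_(b i.+1)),
        v *m phi i = 0 <-> exists w, v = w *m phi i.+1).

Definition componentwise_linear L : Prop :=
  forall j : nat, linear_resolution (ideal_gen (fun f => L f /\ f \is j.-homog)).

                                                                        
Definition norm_depth L (k : nat) : extended int :=
  if (1 <= k <= monomial_grade L)%N then
    EFin ((depth_quot (sqfree_pow L k))%:Z - ((indeg (sqfree_pow L k))%:Z - 1))
  else EPInf int.

                                                                        
Definition indeg_pow L (k : nat) : int :=
  if k is 0%N then 0 else (indeg (sqfree_pow L k))%:Z.

End Ideals.

                                                              
Definition adjoin_var (K : fieldType) (n : nat) (I : {mpoly K[n]} -> Prop) :
    {mpoly K[n.+1]} -> Prop :=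
  ideal_gen (fun f => (exists2 g, I g & f = mwiden g) \/ f = 'X_ord_max).

(* Main.v *)
Require Import Defs.
From mathcomp Require Import all_boot all_order all_algebra.
From mathcomp Require Import zify.
From Stdlib Require Import ClassicalEpsilon.

Set Implicit Arguments.
Unset Strict Implicit.
Unset Printing Implicit Defensive.

Import Order.TTheory GRing.Theory Num.Theory.
Local Open Scope ring_scope.

(** Write S' and S for the two polynomial rings, and put L1 = I^[k] and
    L0 = I^[k-1].  As x is a new variable, J^[k] = L1 + x L0, and the initial
    degree of J^[k] is one more than that of L0 (a monomial of L1 is a proper
    multiple of a monomial of L0).  So the formula for g_J says exactly that

      depth S/(L1 + x L0) = min (depth S'/L1, (depth S'/L0) + 1),

    where L0 = S' and L1 = 0, the two ends of the range of k, drop one of the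
    two terms.

    Depth is turned into a statement about Koszul homology on the variables:
    for an ideal L of T = K[x1, ..., xn] contained in (x) = (x1, ..., xn), there
    is a regular sequence of length r on T/L in (x) if and only if
    H_i (x; T/L) = 0 for all i > n - r ([depth_quotP]).  Going modulo a regular
    element f of (x) moves the bound on i by one because f kills Koszul homology
    ([kvanish_adjoin1]); and when the top homology vanishes, no nonzero element
    of T/L is killed by all the variables, so that prime avoidance, in a
    noetherian ring, yields a regular element to go on with
    ([regular_element_exists]).

    In x-degree 0 the Koszul complex of S/(L1 + x L0) is that of S'/L1, in
    x-degree 1 it is the mapping cone of the projection from the complex of
    S'/L1 to the complex of S'/L0, and in higher x-degrees it is acyclic.  If
    the projection is zero on homology in positive degrees, the homology of the
    cone is made of that of S'/L0 and of that of S'/L1 shifted by one, and the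
    depth formula follows ([kvanish_cone], [kvanish_cone_inv]).

    For k = 1 the complex of S'/L0 is zero; for k > 1 the projection is zero on
    homology because L0 is componentwise linear ([componentwise_linear_cycles]).
    A monomial of L1 of degree j + 1 is a variable times a monomial of L0 of
    degree j, so a Koszul cycle with entries of degree j + 1 in L1 has its
    entries in m N, for m the ideal of the variables and N the ideal generated
    by the part of degree j of L0.  Such a cycle lifts to the tensor product of
    the Koszul complex with a linear resolution of N; chasing it through this
    double complex, all liftings can be kept with entries in m since the
    matrices are linear, and the exactness of the Koszul complex of S' makes the
    cycle a boundary with entries in N.

    On the combinatorial side, a monomial lies in I^[k] if and only if a product
    of k monomials of I with pairwise disjoint supports divides it, and a
    sequence of nonunit monomials is regular if and only if their supports are
    pairwise disjoint ([regular_monomials]).  This computes the monomial grade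
    and describes J^[k] ([sqfree_pow_adjoin]). *)

(** * Ideals and noetherian rings *)

(** Ideals are kept as predicates, without decidable membership, as in the
    theorem. *)
Record is_ideal (R : comNzRingType) (L : R -> Prop) : Prop := IsIdeal {
  ideal0 : L 0;
  idealD : forall f g, L f -> L g -> L (f + g);
  idealM : forall a f, L f -> L (a * f) }.

Section IdealBasics.
Variables (R : comNzRingType) (L : R -> Prop).
Hypothesis idL : is_ideal L.

Lemma idealN f : L f -> L (- f).
Proof. by rewrite -mulN1r; apply: idealM. Qed.

Lemma idealB f g : L f -> L g -> L (f - g).
Proof. by move=> ? /idealN; apply: idealD. Qed.

Lemma ideal_sum (T : Type) (s : seq T) (P : pred T) F :
  (forall i, P i -> L (F i)) -> L (\sum_(i <- s | P i) F i).
Proof. by move=> LF; apply: big_ind => //; [apply: ideal0 | apply: idealD]. Qed.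

Lemma ideal_sum_mem (T : eqType) (s : seq T) F :
  (forall i, i \in s -> L (F i)) -> L (\sum_(i <- s) F i).
Proof. by move=> LF; rewrite big_seq; apply: ideal_sum. Qed.

End IdealBasics.

(** The chain condition, rather than finite generation: it passes to polynomial
    rings without any choice of generators. *)
Definition noetherian (R : comNzRingType) := forall C : nat -> R -> Prop,
  (forall k, is_ideal (C k)) -> (forall k f, C k f -> C k.+1 f) ->
  exists N, forall k f, C k f -> C N f.

Lemma chain_le (T : Type) (C : nat -> T -> Prop) :
  (forall k f, C k f -> C k.+1 f) ->
  forall k l f, (k <= l)%N -> C k f -> C l f.
Proof.
move=> Cle k l f /subnK<-; elim: (l - k)%N => // d IH /IH.
by rewrite addSn; apply: Cle.
Qed.

(** Hilbert's basis theorem.  For a chain of ideals C k, the coefficients in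
    degree d of the members of C k of degree at most d form an ideal of R that
    grows with both k and d.  The diagonal of this doubly indexed family is
    stationary from some N on, and so is each of the N rows d < N; beyond the
    bound so obtained, a polynomial of C k can be reduced in degree by elements
    of one fixed ideal of the chain. *)
Lemma noetherian_poly (R : comNzRingType) :
  noetherian R -> noetherian {poly R}.
Proof.
move=> noethR C idC Cle.
pose lead k d (c : R) := exists p : {poly R}, [/\ C k p, (size p <= d.+1)%N & c = p`_d].
have idl k d : is_ideal (lead k d).
  split.
  - by exists 0; rewrite size_poly0 coef0; split=> //; apply: (ideal0 (idC k)).
  - move=> _ _ [p [Cp sp ->]] [q [Cq sq ->]]; exists (p + q); split.
    + exact: (idealD (idC k)).
    + by rewrite (leq_trans (size_polyD _ _)) // geq_max sp.
    + by rewrite coefD.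
  - move=> a _ [p [Cp sp ->]]; exists (a%:P * p); split.
    + exact: (idealM (idC k)).
    + by rewrite mul_polyC (leq_trans (size_scale_leq _ _)).
    + by rewrite coefCM.
have lead_k d k c : lead k d c -> lead k.+1 d c.
  by case=> p [Cp sp ->]; exists p; split=> //; apply: Cle.
have lead_d k d c : lead k d c -> lead k d.+1 c.
  case=> p [Cp sp ->]; exists ('X * p); split.
  - exact: (idealM (idC k)).
  - by rewrite mulrC (leq_trans (size_polyMleq _ _)) // size_polyX addn2.
  - by rewrite coefXM.
have lead_kd k l d e c : (k <= l)%N -> (d <= e)%N -> lead k d c -> lead l e c.
  move=> kl de /(chain_le (lead_d k) de).
  exact: (chain_le (lead_k e) kl).
have [N HN] : exists N, forall k c, lead k k c -> lead N N c.
  by apply: noethR => // k c; apply: lead_kd.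
have [M HM] : exists M, forall d k c, (d < N)%N -> lead k d c -> lead M d c.
  elim: N {HN} => [|N [M HM]]; first by exists 0%N.
  have [M' HM'] : exists M', forall k c, lead k N c -> lead M' N c.
    exact: (noethR (fun k => lead k N) _ (lead_k N)).
  exists (maxn M M') => d k c; rewrite ltnS leq_eqVlt => /predU1P[->|dN] /= H.
    by apply: lead_kd (HM' _ _ H) => //; rewrite leq_maxr.
  by apply: lead_kd (HM _ _ _ dN H) => //; rewrite leq_maxl.
pose P := maxn M N.
have HP k d c : lead k d c -> lead P d c.
  case: (ltnP d N) => dN H.
    by apply: lead_kd (HM _ _ _ dN H) => //; rewrite leq_maxl.
  apply: (@lead_kd N _ N) (HN (maxn k d) _ _) => //; first by rewrite leq_maxr.
  by apply: lead_kd H; rewrite ?leq_maxl ?leq_maxr.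
exists P => k p Cp.
have [k' [Pk' {Cp}]] : exists k', (P <= k')%N /\ C k' p.
  by exists (maxn P k); split; [rewrite leq_maxl | apply: (chain_le Cle) Cp; rewrite leq_maxr].
have [s] := ubnP (size p); elim: s p => // d IH p; rewrite ltnS leq_eqVlt.
case/predU1P=> [sp|]; last exact: IH.
move=> Cp; case: d => [|d] in sp IH *.
  by move/eqP: sp; rewrite size_poly_eq0 => /eqP->; apply: (ideal0 (idC _)).
have /HP[q [Cq sq pq]] : lead k' d p`_d by exists p; rewrite sp.
rewrite -(subrK q p); apply: (idealD (idC P)) => //; apply: IH; last first.
  by apply: (idealB (idC k')) => //; apply: (chain_le Cle) Cq.
rewrite ltnS; apply/leq_sizeP => j; rewrite leq_eqVlt => /predU1P[<-|dj].
  by rewrite coefB pq subrr.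
by rewrite coefB !nth_default ?subrr // ?sp //; apply: leq_trans sq _.
Qed.

Lemma noetherian_iso (R S : comNzRingType) (phi : {rmorphism R -> S})
    (psi : S -> R) : cancel phi psi -> cancel psi phi ->
  noetherian S -> noetherian R.
Proof.
move=> phiK psiK noethS C idC Cle.
have [k|k f|N HN] := noethS (fun k f => C k (psi f)).
- have inj := can_inj phiK.
  have psiD f g : psi (f + g) = psi f + psi g.
    by apply: inj; rewrite rmorphD /= !psiK.
  have psiM f g : psi (f * g) = psi f * psi g.
    by apply: inj; rewrite rmorphM /= !psiK.
  have psi0 : psi 0 = 0 by apply: inj; rewrite psiK rmorph0.
  split=> [|f g|a f]; rewrite ?psi0 ?psiD ?psiM.
  + exact: ideal0.
  + exact: idealD.
  + exact: idealM.
- exact: Cle.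
by exists N => k f Cf; rewrite -(phiK f); apply: (HN k); rewrite phiK.
Qed.

Lemma noetherian_field (R : comNzRingType) :
  (forall f : R, f != 0 -> exists g, g * f = 1) -> noetherian R.
Proof.
move=> Rfield C idC Cle.
case: (classic (exists k f, C k f /\ f != 0)) => [[k [f [Cf /Rfield[g gf]]]]|H].
  exists k => l h _; rewrite -(mulr1 h) -gf mulrA.
  exact: (idealM (idC k)).
exists 0%N => k f Cf; have [->|f0] := eqVneq f 0; first exact: (ideal0 (idC _)).
by case: H; exists k, f.
Qed.

(** If each member of F were strictly inside another one, dependent choice would
    build a chain that never stops. *)
Lemma noetherian_max (R : comNzRingType) (F : (R -> Prop) -> Prop) :
  noetherian R -> (forall L, F L -> is_ideal L) -> (exists L, F L) ->
  exists L, F L /\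
    forall L', F L' -> (forall f, L f -> L' f) -> forall f, L' f -> L f.
Proof.
move=> noethR idF [L0 FL0]; apply: NNPP => nomax.
have next (L : {L | F L}) : exists L' : {L | F L},
    (forall f, sval L f -> sval L' f) /\ exists f, sval L' f /\ ~ sval L f.
  case: L => L FL; apply: NNPP => H; apply: nomax; exists L; split=> // L' FL' LL'.
  move=> f L'f; apply: NNPP => nLf; apply: H; exists (exist _ L' FL') => /=.
  by split=> //; exists f.
pose nx L := sval (constructive_indefinite_description _ (next L)).
have nxP L := svalP (constructive_indefinite_description _ (next L)).
pose C k := sval (iter k nx (exist _ L0 FL0)).
have [k|k f|N HN] := noethR C.
- by apply: idF; apply: svalP.
- by rewrite /C /=; have [H _] := nxP (iter k nx (exist _ L0 FL0)); apply: H.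
have [_ [f [Cf nCf]]] := nxP (iter N nx (exist _ L0 FL0)).
by apply: nCf; apply: (HN N.+1).
Qed.

Section RegularElement.
Variables (R : comNzRingType) (L : R -> Prop).
Hypotheses (noethR : noetherian R) (idL : is_ideal L).

Let colon h : R -> Prop := fun f => L (f * h).
Let maxcolon h := ~ L h /\ forall h', ~ L h' ->
  (forall f, colon h f -> colon h' f) -> forall f, colon h' f -> colon h f.

Let id_colon h : is_ideal (colon h).
Proof.
split=> [|f g|a f]; rewrite /colon ?mul0r ?mulrDl -?mulrA.
- exact: ideal0.
- exact: idealD.
- exact: idealM.
Qed.

(** A maximal proper colon ideal is prime: such an ideal is an associated prime
    of the quotient by L. *)
Let maxcolon_prime h f g :
  maxcolon h -> colon h (f * g) -> ~ colon h g -> colon h f.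
Proof.
move=> [nLh maxh] fg ng; apply: (maxh (g * h)) => //; last by rewrite /colon mulrA.
by move=> f'; rewrite /colon mulrCA; apply: idealM.
Qed.

(** The product of elements outside a prime ideal stays outside; choosing one in
    each of finitely many other ideals puts it inside all of them. *)
Let maxcolon_separate h (hs : seq R) : maxcolon h ->
  (forall h', h' \in hs -> exists t, colon h' t /\ ~ colon h t) ->
  exists u, ~ colon h u /\ forall h', h' \in hs -> colon h' u.
Proof.
move=> maxh; elim: hs => [_|h' s IH H].
  by exists 1; split=> //; rewrite /colon mul1r; case: maxh.
have [|u [nu Hu]] := IH.
  by move=> h'' h''s; apply: H; rewrite inE h''s orbT.
have [t [h't nt]] := H h' (mem_head _ _).
exists (u * t); split; first by move=> /(maxcolon_prime maxh)/(_ nt).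
move=> h''; rewrite inE => /predU1P[->|/Hu h''u]; first exact: (idealM (id_colon _)).
by rewrite mulrC; apply: (idealM (id_colon _)).
Qed.

Let maxcolon_exists f h : ~ L h -> L (f * h) ->
  exists h', maxcolon h' /\ colon h' f.
Proof.
move=> nLh Lfh; pose F C := exists h', [/\ ~ L h', L (f * h') & C = colon h'].
have [||C [[h' [nLh' Lfh' ->]] maxC]] := @noetherian_max R F noethR.
- by move=> _ [h' [_ _ ->]].
- by exists (colon h), h.
exists h'; split=> //; split=> // h'' nLh'' le; apply: maxC => //.
by exists h''; split=> //; apply: le.
Qed.

(** Prime avoidance for finitely many maximal colon ideals.  Distinct maximal
    ones are incomparable, so an element that avoids all but one of them can be
    corrected by an element of M that lies in all but that one. *)
Let avoid (M : R -> Prop) (hs : seq R) : is_ideal M ->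
  (forall h, h \in hs -> maxcolon h) ->
  (forall h, h \in hs -> exists f, M f /\ ~ colon h f) ->
  exists f, M f /\ forall h, h \in hs -> ~ colon h f.
Proof.
move=> idM; elim: hs => [|h hs IH] maxhs Mhs.
  by exists 0; split=> //; apply: ideal0.
have inhs h' : h' \in hs -> h' \in h :: hs by rewrite inE orbC => ->.
have [||f [Mf Hf]] := IH; [by move=> h' /inhs/maxhs | by move=> h' /inhs/Mhs |].
have maxh : maxcolon h by apply: maxhs; rewrite mem_head.
case: (classic (colon h f)) => [hf|]; last first.
  by move=> nhf; exists f; split=> // h'; rewrite inE => /predU1P[->|/Hf].
have [g [Mg nhg]] := Mhs h (mem_head _ _).
have [u [nu Hu]] : exists u, ~ colon h u /\ forall h', h' \in hs -> colon h' u.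
  apply: maxcolon_separate => // h' h's; apply: NNPP => H; apply: (Hf h' h's).
  have [nLh' maxh'] := maxhs h' (inhs _ h's).
  apply: (maxh' h) => //; first by case: maxh.
  by move=> t h't; apply: NNPP => nht; apply: H; exists t.
(* u lies in every other colon ideal but not in that of h, which contains f and
   does not contain g. *)
exists (f + u * g); split; first by apply: (idealD idM) => //; apply: (idealM idM).
move=> h'; rewrite inE => /predU1P[->|h's] H.
  apply: nu; apply: (maxcolon_prime maxh _ nhg).
  by rewrite -(addKr f (u * g)) addrC; apply: (idealB (id_colon _)).
apply: (Hf h' h's); rewrite -(addrK (u * g) f); apply: (idealB (id_colon _)) => //.
by rewrite mulrC; apply: (idealM (id_colon _)); apply: Hu.
Qed.

(** If every element of M is a zero divisor modulo L, each lies in some maximal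
    colon ideal.  Finitely many of these ideals suffice: take representatives hs
    for which L + (hs) is maximal.  An element h' whose colon ideal is maximal
    then lies in L + (hs), so its colon ideal contains the intersection of those
    of hs, hence one of them, hence equals it.  An element of M avoiding the
    colon ideals of hs is therefore regular. *)
Lemma regular_element_exists (M : R -> Prop) : is_ideal M ->
  (forall h, (forall f, M f -> L (f * h)) -> L h) ->
  exists f, M f /\ forall h, L (f * h) -> L h.
Proof.
move=> idM socle.
pose span hs (g : R) := exists a : R -> R, L (g - \sum_(h <- hs) a h * h).
have id_span hs : is_ideal (span hs).
  split=> [|f g [a Ha] [b Hb]|c f [a Ha]].
  - exists (fun _ => 0); rewrite big1 ?subr0 => [|i _]; last by rewrite mul0r.
    exact: ideal0.
  - exists (fun h => a h + b h).
    rewrite (eq_bigr (fun h => a h * h + b h * h)) => [|h _]; last by rewrite mulrDl.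
    by rewrite big_split /= opprD addrACA; apply: idealD.
  - exists (fun h => c * a h).
    rewrite (eq_bigr (fun h => c * (a h * h))) => [|h _]; last by rewrite mulrA.
    by rewrite -mulr_sumr -mulrBr; apply: idealM.
pose F C := exists hs, (forall h, h \in hs -> maxcolon h) /\ C = span hs.
have [||C [[hs [maxhs ->]] maxC]] := @noetherian_max R F noethR.
- by move=> _ [hs [_ ->]].
- by exists (span [::]), [::].
have [h hhs||f [Mf Hf]] := @avoid M hs idM.
- exact: maxhs.
- move=> h hhs; apply: NNPP => H; have [nLh _] := maxhs h hhs.
  apply: nLh; apply: socle => f Mf; apply: NNPP => nf; apply: H.
  by exists f.
exists f; split=> // h Lfh; apply: NNPP => nLh.
have [h' [maxh' h'f]] := maxcolon_exists nLh Lfh.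
have h'hs : h' \notin hs by apply/negP=> /Hf.
have [|||a Ha] := maxC (span (h' :: hs)) _ _ h'.
- exists (h' :: hs); split=> // h''; rewrite inE => /predU1P[-> //|]; exact: maxhs.
- move=> g [a Ha]; exists (fun h => if h == h' then 0 else a h).
  rewrite big_cons eqxx mul0r add0r big_seq.
  under eq_bigr => i ihs do rewrite (negPf (memPn h'hs i ihs)).
  by rewrite -big_seq.
- exists (fun h => (h == h')%:R); rewrite big_cons eqxx mul1r big_seq big1 => [|i ihs].
    by rewrite addr0 subrr; apply: ideal0.
  by rewrite (negPf (memPn h'hs i ihs)) mul0r.
have [h1 [h1hs sub]] : exists h1, h1 \in hs /\ forall t, colon h1 t -> colon h' t.
  apply: NNPP => H.
  have [|u [nu Hu]] := maxcolon_separate (hs := hs) maxh'.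
    move=> h1 h1hs; apply: NNPP => H'; apply: H; exists h1; split=> // t h1t.
    by apply: NNPP => nt; apply: H'; exists t.
  apply: nu; rewrite /colon -(subrK (\sum_(h <- hs) a h * h) h') mulrDr.
  apply: idealD => //; first exact: idealM.
  rewrite mulr_sumr; apply: ideal_sum_mem => // h1 h1hs.
  by rewrite mulrCA; apply: idealM => //; apply: Hu.
apply: (Hf h1 h1hs); have [_ maxh1] := maxhs h1 h1hs.
by apply: (maxh1 h') => //; case: maxh'.
Qed.

End RegularElement.

(** * The Koszul complex modulo an ideal *)

Definition mx_in (R : comNzRingType) (L : R -> Prop) m n (A : 'M[R]_(m, n)) :=
  forall i j, L (A i j).

Section MatricesOverIdeal.
Variables (R : comNzRingType) (L : R -> Prop).
Hypothesis idL : is_ideal L.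

Lemma mx_in0 m n : mx_in L (0 : 'M_(m, n)).
Proof. by move=> i j; rewrite mxE; apply: ideal0. Qed.

Lemma mx_inD m n (A B : 'M_(m, n)) : mx_in L A -> mx_in L B -> mx_in L (A + B).
Proof. by move=> LA LB i j; rewrite mxE; apply: idealD. Qed.

Lemma mx_inN m n (A : 'M_(m, n)) : mx_in L A -> mx_in L (- A).
Proof. by move=> LA i j; rewrite mxE; apply: idealN. Qed.

Lemma mx_inB m n (A B : 'M_(m, n)) : mx_in L A -> mx_in L B -> mx_in L (A - B).
Proof. by move=> LA LB; apply: mx_inD => //; apply: mx_inN. Qed.

Lemma mx_inMl m n p (A : 'M_(m, n)) (B : 'M_(n, p)) : mx_in L B -> mx_in L (A *m B).
Proof.
by move=> LB i j; rewrite mxE; apply: ideal_sum => // k _; apply: idealM.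
Qed.

Lemma mx_inMr m n p (A : 'M_(m, n)) (B : 'M_(n, p)) : mx_in L A -> mx_in L (A *m B).
Proof.
by move=> LB i j; rewrite mxE; apply: ideal_sum => // k _; rewrite mulrC; apply: idealM.
Qed.

Lemma mx_inZ m n a (A : 'M_(m, n)) : mx_in L A -> mx_in L (a *: A).
Proof. by move=> LA i j; rewrite mxE; apply: idealM. Qed.

Lemma mx_in_scalar n a : L a -> mx_in L (a%:M : 'M_n).
Proof. by move=> La i j; rewrite mxE; case: (i == j) => //; apply: ideal0. Qed.

Lemma mx_in_col m1 m2 n (A : 'M_(m1, n)) (B : 'M_(m2, n)) :
  mx_in L (col_mx A B) <-> mx_in L A /\ mx_in L B.
Proof.
split=> [H|[LA LB] i j]; last by rewrite mxE; case: split.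
split=> i j; first by have := H (lshift _ i) j; rewrite col_mxEu.
by have := H (rshift _ i) j; rewrite col_mxEd.
Qed.

Lemma mx_in_block m1 m2 n1 n2 (A : 'M_(m1, n1)) (B : 'M_(m1, n2))
    (C : 'M_(m2, n1)) (D : 'M_(m2, n2)) :
  mx_in L A -> mx_in L B -> mx_in L C -> mx_in L D -> mx_in L (block_mx A B C D).
Proof.
by move=> LA LB LC LD i j; rewrite mxE; case: split => k; rewrite mxE; case: split.
Qed.

End MatricesOverIdeal.

(** The Koszul complex on n elements is free of rank 2 ^ n; the recursion makes
    it split, by conversion, into the two halves of a mapping cone. *)
Fixpoint kdim n := if n is n'.+1 then (kdim n' + kdim n')%N else 1%N.

Section Koszul.
Variables (R : comNzRingType) (x : nat -> R).

(** The differential of the Koszul complex on x 0, ..., x (n - 1), acting on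
    columns that hold all homological degrees together.  The complex on n + 1
    elements is the mapping cone of multiplication by x n, whose lower half is
    the shifted copy. *)
Fixpoint kD n : 'M[R]_(kdim n) :=
  if n is n'.+1 then block_mx (kD n') (x n')%:M 0 (- kD n') else 0.

(** The projection onto homological degrees at least p.  The lower half of the
    cone is shifted by one; for p = 0 the predecessor is 0, which is right since
    nothing lives in degree -1. *)
Fixpoint kQ n p : 'M[R]_(kdim n) :=
  if n is n'.+1 then block_mx (kQ n' p) 0 0 (kQ n' p.-1) else (p == 0%N)%:R%:M.

Lemma kD_sq n : kD n *m kD n = 0.
Proof.
elim: n => [|n IH] /=; first by rewrite mul0mx.
rewrite mulmx_block !mulmx0 !mul0mx !mulmxN !mulNmx IH opprK !addr0.
by rewrite scalar_mxC subrr -block_mx0.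
Qed.

Lemma kQ0 n : kQ n 0 = 1%:M.
Proof. by elim: n => //= n ->; rewrite -scalar_mx_block. Qed.

Lemma kQ_gt n p : (n < p)%N -> kQ n p = 0.
Proof.
elim: n p => [|n IH] [|p] //= np; first by apply/matrixP=> i j; rewrite !mxE mul0rn.
by rewrite !IH -?block_mx0 // ltnW.
Qed.

Lemma kQM n p q : kQ n p *m kQ n q = kQ n (maxn p q).
Proof.
elim: n p q => [|n IH] p q /=.
  by rewrite -scalar_mxM -natrM mulnb -!leqn0 geq_max.
rewrite mulmx_block !mulmx0 !mul0mx !addr0 !IH !add0r.
by congr (block_mx _ _ _ (kQ _ _)); lia.
Qed.

(** The differential lowers the homological degree by exactly one. *)
Lemma kQD n p : kQ n p *m kD n = kD n *m kQ n p.+1.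
Proof.
elim: n p => [|n IH] p /=; first by rewrite mul0mx mulmx0.
rewrite !mulmx_block !mulmx0 !mul0mx !addr0 !add0r IH -scalar_mxC.
congr block_mx; rewrite mulmxN mulNmx; congr (- _).
by case: p => [|p] /=; rewrite ?kQ0 ?mul1mx ?mulmx1 ?IH.
Qed.

Lemma kQ_le n p q m (z : 'M_(_, m)) : (p <= q)%N -> kQ n q *m z = z -> kQ n p *m z = z.
Proof. by move=> pq <-; rewrite mulmxA kQM (maxn_idPr pq). Qed.

Lemma kQ_id n p m (z : 'M_(_, m)) : kQ n p *m (kQ n p *m z) = kQ n p *m z.
Proof. by rewrite mulmxA kQM maxnn. Qed.

Lemma kQ_D n p m (z : 'M_(_, m)) :
  kQ n p *m z = z -> kQ n p.-1 *m (kD n *m z) = kD n *m z.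
Proof.
case: p => [|p] /= Qz; first by rewrite kQ0 mul1mx.
by rewrite mulmxA kQD -mulmxA Qz.
Qed.

Lemma kD_in (L : R -> Prop) n : is_ideal L ->
  (forall i, (i < n)%N -> L (x i)) -> mx_in L (kD n).
Proof.
move=> idL; elim: n => [|n IH] Lx /=; first exact: mx_in0.
have LD : mx_in L (kD n) by apply: IH => i i_n; apply: Lx; rewrite ltnW.
apply: mx_in_block => //; [apply: mx_in_scalar | apply: mx_in0 | apply: mx_inN] => //.
exact: Lx.
Qed.

(** Every element of the ideal generated by the x i acts on the Koszul complex
    as zero up to homotopy.  In the inductive step, the map from the upper half
    of the cone to the lower one is a homotopy for the new element. *)
Lemma koszul_homotopy n (a : nat -> R) : exists h : 'M_(kdim n),
  h *m kD n + kD n *m h = (\sum_(i < n) a i * x i)%:M /\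
  forall p, kQ n p.+1 *m h = h *m kQ n p.
Proof.
elim: n => [|n [h [Hh Qh]]].
  exists 0; rewrite /= big_ord0 !mul0mx addr0 -scalemx1 scale0r; split=> // p.
  by rewrite mulmx0 mul0mx.
exists (block_mx h 0 (a n)%:M (- h)); split=> [|p] /=.
  rewrite !mulmx_block !mulmx0 !mul0mx add_block_mx !addr0 !add0r.
  rewrite big_ord_recr /= !mulmxN !mulNmx !opprK -!scalar_mxM.
  rewrite (scalar_mxC (x n)) subrr scalar_mxC subrr.
  rewrite (mulrC (x n)) -[X in block_mx _ _ _ X]addrA (addrA (h *m kD n)) Hh -!raddfD /=.
  by rewrite (addrC (a n * x n)) -scalar_mx_block.
rewrite !mulmx_block !mulmx0 !mul0mx !addr0 !add0r Qh scalar_mxC.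
congr block_mx; rewrite mulmxN mulNmx; congr (- _).
by case: p => [|p] /=; rewrite ?kQ0 ?mul1mx ?mulmx1 ?Qh.
Qed.

(** Generators of the Koszul complex in the extreme degrees 0 and n. *)
Fixpoint kbot n : 'cV[R]_(kdim n) := if n is n'.+1 then col_mx (kbot n') 0 else 1%:M.
Fixpoint ktop n : 'cV[R]_(kdim n) := if n is n'.+1 then col_mx 0 (ktop n') else 1%:M.

Lemma kbot_entry n : exists i, kbot n i 0 = 1.
Proof.
elim: n => [|n [i Hi]] /=; first by exists 0; rewrite mxE eqxx.
by exists (lshift _ i); rewrite col_mxEu.
Qed.

Lemma ktop_entry n : exists i, ktop n i 0 = 1.
Proof.
elim: n => [|n [i Hi]] /=; first by exists 0; rewrite mxE eqxx.
by exists (rshift _ i); rewrite col_mxEd.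
Qed.

Lemma kD_bot n : kD n *m kbot n = 0.
Proof.
elim: n => [|n IH] /=; first by rewrite mul0mx.
by rewrite mul_block_col IH mulmx0 mul0mx mulmx0 !addr0 col_mx0.
Qed.

Lemma kQ_top n : kQ n n *m ktop n = ktop n.
Proof.
elim: n => [|n IH] /=; first by rewrite mul1mx.
by rewrite mul_block_col IH mulmx0 !mul0mx addr0 add0r.
Qed.

Lemma kQ1_compl n (z : 'cV_(kdim n)) : exists i, z - kQ n 1 *m z = z i 0 *: kbot n.
Proof.
elim: n z => [|n IH] z /=.
  exists 0; rewrite (_ : 0%:R%:M = 0) ?mul0mx ?subr0; last by rewrite -scalemx1 scale0r.
  by rewrite scalemx1; apply/matrixP=> i j; rewrite !ord1 !mxE eqxx.
rewrite -[z]vsubmxK mul_block_col kQ0 mul1mx !mul0mx addr0 add0r.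
rewrite opp_col_mx add_col_mx subrr.
have [i ->] := IH (usubmx z); exists (lshift _ i).
by rewrite scale_col_mx scaler0 col_mxEu.
Qed.

(** H_i (x; R/L) = 0 for all i >= p.  The support of the bounding chain w is
    free, since [kvanish_supp] can truncate it. *)
Definition kvanish n (L : R -> Prop) p := forall z : 'cV_(kdim n),
  kQ n p *m z = z -> mx_in L (kD n *m z) -> exists w, mx_in L (z - kD n *m w).

Lemma kvanish_ext n L L' p : (forall f, L f <-> L' f) -> kvanish n L p -> kvanish n L' p.
Proof.
move=> LL' VL z Qz Lz; have [|w Hw] := VL z Qz; first by move=> i j; apply/LL'.
by exists w => i j; apply/LL'.
Qed.

Lemma kvanish_le n L p q : (p <= q)%N -> kvanish n L p -> kvanish n L q.
Proof. by move=> pq VL z /(kQ_le pq); apply: VL. Qed.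

Section Vanishing.
Variables (n : nat) (L : R -> Prop).
Hypothesis idL : is_ideal L.

Lemma kvanish_gt p : (n < p)%N -> kvanish n L p.
Proof.
move=> np z; rewrite kQ_gt // mul0mx => <- _; exists 0.
by rewrite mulmx0 subr0; apply: mx_in0.
Qed.

Lemma kvanish_supp p (z : 'cV_(kdim n)) : kvanish n L p ->
  kQ n p *m z = z -> mx_in L (kD n *m z) ->
  exists w, kQ n p.+1 *m w = w /\ mx_in L (z - kD n *m w).
Proof.
move=> VL Qz Lz; have [w Hw] := VL z Qz Lz.
exists (kQ n p.+1 *m w); split; first exact: kQ_id.
by rewrite mulmxA -kQD -mulmxA -{1}Qz -mulmxBr; apply: mx_inMl.
Qed.

(** In degree 0 the homology is R modulo L and the x i. *)
Lemma kvanish0 (M : R -> Prop) : is_ideal M -> (forall f, L f -> M f) ->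
  (forall i, (i < n)%N -> M (x i)) -> kvanish n L 0 -> M 1.
Proof.
move=> idM LM Mx VL; have [||w Hw] := VL (kbot n).
- by rewrite kQ0 mul1mx.
- by rewrite kD_bot; apply: mx_in0.
have [i <-] := kbot_entry n; rewrite -(subrK (kD n *m w) (kbot n)) mxE.
apply: (idealD idM); first exact: LM.
by apply: mx_inMr => //; apply: kD_in.
Qed.

(** In degree n there are no boundaries, and the cycles are the elements of R/L
    killed by every x i. *)
Lemma kvanish_top : kvanish n L n ->
  forall h, (forall i, (i < n)%N -> L (x i * h)) -> L h.
Proof.
move=> VL h Lxh; have [||w [Qw Hw]] := @kvanish_supp n (h *: ktop n) VL.
- by rewrite -scalemxAr kQ_top.
- have id_colon : is_ideal (fun f => L (f * h)).
    split=> [|f g|a f]; rewrite ?mul0r ?mulrDl -?mulrA.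
    + exact: ideal0.
    + exact: idealD.
    + exact: idealM.
  rewrite -scalemxAr scalemxAl; apply: mx_inMr => // i j.
  by rewrite mxE mulrC; apply: (kD_in id_colon Lxh).
have [i Hi] := ktop_entry n; have := Hw i 0.
by rewrite -Qw kQ_gt // mul0mx mulmx0 subr0 mxE Hi mulr1.
Qed.

Definition adjoin1 f : R -> Prop := fun g => exists a, L (g - a * f).

Lemma adjoin1_ideal f : is_ideal (adjoin1 f).
Proof.
split=> [|g h [a Ha] [b Hb]|c g [a Ha]].
- by exists 0; rewrite mul0r subrr; apply: ideal0.
- by exists (a + b); rewrite mulrDl opprD addrACA; apply: idealD.
- by exists (c * a); rewrite -mulrA -mulrBr; apply: idealM.
Qed.

Lemma adjoin1_mx f m k (A : 'M_(m, k)) :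
  mx_in (adjoin1 f) A <-> exists B, mx_in L (A - f *: B).
Proof.
split=> [H|[B HB] i j]; last first.
  by exists (B i j); have := HB i j; rewrite !mxE mulrC.
have /fin_all_exists[B HB] i : exists b, forall j, L (A i j - b j * f).
  by have /fin_all_exists[b Hb] := H i; exists b.
by exists (\matrix_(i, j) B i j) => i j; rewrite !mxE mulrC.
Qed.

(** The long exact sequence of multiplication by f on R/L breaks into short ones
    because f, being a combination of the x i, acts as zero on homology.  So
    H_i modulo (L, f) vanishes exactly when H_i and H_(i-1) modulo L do. *)
Lemma kvanish_adjoin1 (a : nat -> R) p f :
    f = \sum_(i < n) a i * x i -> (forall h, L (f * h) -> L h) ->
  kvanish n L p <-> kvanish n (adjoin1 f) p.+1.
Proof.
move=> def_f regf; have [h []] := koszul_homotopy n a; rewrite -def_f => Hh Qh.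
have regmx m k (A : 'M_(m, k)) : mx_in L (f *: A) -> mx_in L A.
  by move=> LA i j; apply: regf; have := LA i j; rewrite mxE.
have idA := adjoin1_ideal f.
split=> VL z Qz.
  move=> /adjoin1_mx[u Hu].
  (* The correction u may be truncated to the degrees in which D z lives. *)
  have {}Hu : mx_in L (kD n *m z - f *: (kQ n p *m u)).
    have -> : kD n *m z = kQ n p *m (kD n *m z) by rewrite (kQ_D Qz).
    by rewrite scalemxAr -mulmxBr; apply: mx_inMl.
  move: (kQ n p *m u) (kQ_id p u) Hu => {}u Qu Hu.
  have [|w [Qw Hw]] := kvanish_supp VL Qu.
    apply: regmx; have := mx_inMl idL (kD n) Hu.
    rewrite mulmxBr mulmxA kD_sq mul0mx sub0r scalemxAr => /(mx_inN idL).
    by rewrite opprK.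
  (* With u bounding w modulo L, z - f w is a cycle modulo L itself. *)
  have [||y Hy] := VL (z - f *: w).
  - by rewrite mulmxBr -scalemxAr (kQ_le (leqnSn p) Qz) (kQ_le (leqnSn p) Qw).
  - rewrite mulmxBr -scalemxAr -(subrK (f *: u) (kD n *m z)) -addrA -scalerBr.
    by apply: mx_inD => //; apply: mx_inZ.
  exists y; apply/adjoin1_mx; exists w; by rewrite addrAC.
(* For a cycle z modulo L, the homotopy gives f z = D (h z) modulo L and h z is a
   cycle modulo L and f: this is the connecting map. *)
move=> Lz; have [||w] := VL (h *m z).
- by rewrite mulmxA Qh -mulmxA Qz.
- apply/adjoin1_mx; exists z; rewrite -mul_scalar_mx -Hh mulmxDl -!mulmxA.
  by rewrite opprD addrCA subrr addr0; apply: mx_inN => //; apply: mx_inMl.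
move=> /adjoin1_mx[u Hu]; exists u; apply: regmx.
rewrite scalerBr -{1}mul_scalar_mx -Hh mulmxDl -!mulmxA -addrA.
apply: mx_inD => //; first exact: mx_inMl.
have := mx_inMl idL (kD n) Hu.
by rewrite !mulmxBr !mulmxA kD_sq mul0mx subr0 -scalemxAr.
Qed.

End Vanishing.

End Koszul.

(** * Multivariate polynomials as univariate ones *)

Section Univariate.
Variables (K : fieldType) (n : nat).

Local Notation widen := (widen_ord (leqnSn _)).
Lemma ord_max_or_widen (i : 'I_n.+1) : i = ord_max \/ exists j : 'I_n, i = widen j.
Proof.
have [lt_i|le_i] := ltnP i n; [right | left].
  by exists (Ordinal lt_i); apply: val_inj.
by apply: val_inj => /=; apply/eqP; rewrite eqn_leq le_i -ltnS ltn_ord.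
Qed.

(** Monomials in n + 1 variables as pairs of a monomial in the first n variables
    and an exponent of the last one. *)
Definition mnm_restr (m : 'X_{1..n.+1}) : 'X_{1..n} := [multinom m (widen i) | i < n].
Definition mnm_ext (m : 'X_{1..n}) t : 'X_{1..n.+1} := (mnmwiden m + U_(ord_max) *+ t)%MM.

Lemma mnm_extE m t i : mnm_ext m t (widen i) = m i.
Proof.
rewrite /mnm_ext mnmDE mulmnE mnm1E mnmwiden_widen -val_eqE /=.
by rewrite gtn_eqF ?muln0 ?addn0.
Qed.

Lemma mnm_ext_max m t : mnm_ext m t ord_max = t.
Proof. by rewrite /mnm_ext mnmDE mulmnE mnm1E eqxx mnmwiden_ordmax mul1n. Qed.

Lemma mnm_extP (m m' : 'X_{1..n.+1}) :
  (forall i, m (widen i) = m' (widen i)) -> m ord_max = m' ord_max -> m = m'.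
Proof.
by move=> H Hmax; apply/mnmP => i; have [->|[j ->]] := ord_max_or_widen i.
Qed.

Lemma mnm_restrK m : mnm_ext (mnm_restr m) (m ord_max) = m.
Proof. by apply: mnm_extP => [i|]; rewrite ?mnm_ext_max // mnm_extE mnmE. Qed.

Lemma mnm_extK m t : mnm_restr (mnm_ext m t) = m.
Proof. by apply/mnmP => i; rewrite mnmE mnm_extE. Qed.

(** Membership in monomial ideals is decided on supports; this is what carries it
    through the change of rings. *)
Lemma muni_coef (f : {mpoly K[n.+1]}) t m : ((muni f)`_t)@_m = f@_(mnm_ext m t).
Proof.
rewrite muniE coef_sum [RHS](_ : _ = \sum_(m' <- msupp f) f@_m' * (m' == mnm_ext m t)%:R).
  rewrite raddf_sum /=; apply: eq_bigr => m' _.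
  rewrite -mul_polyC coefCM coefXn -/(mnm_restr m').
  have -> : (m' == mnm_ext m t) = (mnm_restr m' == m) && (t == m' ord_max).
    apply/eqP/andP=> [->|[/eqP<- /eqP->]]; last by rewrite mnm_restrK.
    by rewrite mnm_extK mnm_ext_max !eqxx.
  case: (t == _); last by rewrite andbF !mulr0 mcoeff0.
  by rewrite andbT mulr1 mcoeffZ mcoeffX.
rewrite {1}(mpolyE f) raddf_sum /=; apply: eq_bigr => m' _.
by rewrite mcoeffZ mcoeffX.
Qed.

Lemma muni_inj : injective (@muni n K).
Proof.
move=> f g fg; apply/mpolyP => m; rewrite -(mnm_restrK m).
by rewrite -!muni_coef fg.
Qed.

Lemma muniX m : muni 'X_[m] = ('X_[mnm_restr m])%:P * 'X^(m ord_max) :> {poly {mpoly K[n]}}.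
Proof. by rewrite muniE msuppX big_seq1 mcoeffX eqxx scale1r -mul_polyC. Qed.

Lemma muni_max : muni 'X_ord_max = 'X :> {poly {mpoly K[n]}}.
Proof.
rewrite muniX (_ : mnm_restr _ = 0%MM) ?mpolyX0 ?mul1r ?mnm1E ?eqxx //.
by apply/mnmP=> i; rewrite mnmE mnm1E -val_eqE /= gtn_eqF // mnm0E.
Qed.

Lemma muni_mwiden (f : {mpoly K[n]}) : muni (mwiden f) = f%:P.
Proof.
elim/mpolyind: f => [|c m p _ _ IH]; first by rewrite mwiden0 muni0.
rewrite mwidenD muniD IH mwidenZ mwidenX muniZ muniX mnmwiden_ordmax expr0 mulr1.
have -> : mnm_restr (mnmwiden m) = m.
  by apply/mnmP=> i; rewrite mnmE mnmwiden_widen.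
by rewrite polyCD -mul_polyC -polyCM mul_mpolyC.
Qed.

Definition unmuni (p : {poly {mpoly K[n]}}) : {mpoly K[n.+1]} :=
  \sum_(i < size p) mwiden p`_i * 'X_ord_max ^+ i.

Lemma unmuniK : cancel unmuni (@muni n K).
Proof.
move=> p; rewrite /unmuni raddf_sum /= -[RHS]coefK poly_def.
apply: eq_bigr => i _.
by rewrite muniM muni_mwiden rmorphXn /= muni_max mul_polyC.
Qed.

Lemma muniK : cancel (@muni n K) unmuni.
Proof. by move=> f; apply: muni_inj; rewrite unmuniK. Qed.

End Univariate.

(** Without variables the ring is a field; each variable is dealt with by
    Hilbert's basis theorem. *)
Lemma noetherian_mpoly (K : fieldType) n : noetherian {mpoly K[n]}.
Proof.
elim: n => [|n IH].
  apply: noetherian_field => f f0; exists ((f@_0%MM)^-1%:MP).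
  have m0 (m : 'X_{1..0}) : m = 0%MM by apply/mnmP; case.
  have def_f : f = (f@_0%MM)%:MP.
    by apply/mpolyP=> m; rewrite mcoeffC (m0 m) eqxx mulr1.
  rewrite {2}def_f -mpolyCM mulVf //.
  by apply: contra f0 => /eqP f0; rewrite def_f f0.
apply: (@noetherian_iso _ _ (@muni n K : {rmorphism _ -> _}) (@unmuni K n)).
- exact: muniK.
- exact: unmuniK.
- exact: noetherian_poly.
Qed.

(** * Ideals of a polynomial ring *)

Section MPolyIdeals.
Variables (K : fieldType) (n : nat).
Local Notation T := {mpoly K[n]}.
Implicit Types (L A : T -> Prop).

Lemma ideal_gen_ideal A : is_ideal (ideal_gen A).
Proof.
split=> [|f g [s [As ->]] [t [At ->]]|a f [s [As ->]]].
- by exists [::]; rewrite big_nil.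
- exists (s ++ t); rewrite big_cat; split=> // p.
  by rewrite mem_cat => /orP[/As|/At].
- exists [seq (a * p.1, p.2) | p <- s]; split=> [_ /mapP[p /As Ap ->] //|].
  by rewrite big_map mulr_sumr; apply: eq_bigr => p _; rewrite mulrA.
Qed.

Lemma ideal_gen_mem A f : A f -> ideal_gen A f.
Proof.
move=> Af; exists [:: (1, f)]; rewrite big_seq1 mul1r; split=> // p.
by rewrite inE => /eqP->.
Qed.

(** With [ideal_gen_ideal] and [ideal_gen_mem], the universal property by which
    generated ideals are handled below. *)
Lemma ideal_gen_sub A L : is_ideal L -> (forall f, A f -> L f) ->
  forall f, ideal_gen A f -> L f.
Proof.
move=> idL AL _ [s [As ->]]; apply: ideal_sum_mem => // p /As/AL.
exact: (idealM idL).
Qed.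

Lemma ideal_gen_mono A B : (forall f, A f -> B f) ->
  forall f, ideal_gen A f -> ideal_gen B f.
Proof.
by move=> AB; apply: ideal_gen_sub => [|f /AB]; [apply: ideal_gen_ideal | apply: ideal_gen_mem].
Qed.

Lemma ideal_adjoin_nil L f : is_ideal L -> ideal_adjoin L [::] f <-> L f.
Proof.
move=> idL; split=> [|Lf]; last by apply: ideal_gen_mem; left.
by apply: ideal_gen_sub => // g [].
Qed.

Lemma ideal_adjoin_rcons L s g f : is_ideal L ->
  ideal_adjoin L (rcons s g) f <-> adjoin1 (ideal_adjoin L s) g f.
Proof.
move=> idL; have idLs := ideal_gen_ideal (fun f => L f \/ f \in s).
split.
  apply: ideal_gen_sub; first exact: adjoin1_ideal.
  have sub h : L h \/ h \in s -> adjoin1 (ideal_adjoin L s) g h.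
    by move=> ?; exists 0; rewrite mul0r subr0; apply: ideal_gen_mem.
  move=> h [Lh|]; first by apply: sub; left.
  rewrite mem_rcons inE => /predU1P[->|hs]; last by apply: sub; right.
  by exists 1; rewrite mul1r subrr; apply: (ideal0 idLs).
have idLs' := ideal_gen_ideal (fun f => L f \/ f \in rcons s g).
case=> a Ha; rewrite -(subrK (a * g) f); apply: (idealD idLs').
  move: Ha; apply: ideal_gen_mono => h [Lh|hs]; first by left.
  by right; rewrite mem_rcons inE hs orbT.
by apply: (idealM idLs'); apply: ideal_gen_mem; right; rewrite mem_rcons mem_head.
Qed.

(** The variables as a sequence indexed by all of nat, padded by 0, as the Koszul
    complex expects. *)
Definition mvar i : T := if insub i is Some j then 'X_j else 0.

Lemma mvar_ord (i : 'I_n) : mvar i = 'X_i.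
Proof. by rewrite /mvar valK. Qed.

Definition irrelevant (f : T) : Prop := f@_0%MM = 0.

Lemma irrelevant_ideal : is_ideal irrelevant.
Proof.
split=> [|f g|a f]; rewrite /irrelevant.
- exact: mcoeff0.
- by rewrite mcoeffD => -> ->; rewrite addr0.
- by move=> f0; have := (rmorphM (mcoeff 0%MM : {mpoly K[n]} -> K) a f) => /= ->; rewrite f0 mulr0.
Qed.

Lemma irrelevantX (m : 'X_{1..n}) : irrelevant 'X_[m] <-> m != 0%MM.
Proof.
rewrite /irrelevant mcoeffX; case: eqVneq => // _; split=> // /eqP.
by rewrite oner_eq0.
Qed.

Lemma irrelevant1 : ~ irrelevant 1.
Proof. by rewrite -mpolyX0 irrelevantX eqxx. Qed.

Lemma mnm_neq0 (m : 'X_{1..n}) : m != 0%MM -> exists i, (0 < m i)%N.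
Proof.
move=> m0; apply: NNPP => H; move/eqP: m0; apply; apply/mnmP => i.
by rewrite mnm0E; case: (posnP (m i)) => // mi; case: H; exists i.
Qed.

Lemma mvar_irrelevant i : irrelevant (mvar i).
Proof.
rewrite /mvar; case: insub => [j|]; last exact: (ideal0 irrelevant_ideal).
by apply/irrelevantX; rewrite mnm1_eq0.
Qed.

Lemma irrelevant_comb f : irrelevant f ->
  exists a : nat -> T, f = \sum_(i < n) a i * mvar i.
Proof.
pose comb (f : T) := exists a : nat -> T, f = \sum_(i < n) a i * mvar i.
have idc : is_ideal comb.
  split=> [|_ _ [a ->] [b ->]|c _ [a ->]].
  - by exists (fun _ => 0); rewrite big1 // => i _; rewrite mul0r.
  - exists (fun i => a i + b i); rewrite -big_split.
    by apply: eq_bigr => i _; rewrite mulrDl.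
  - exists (fun i => c * a i); rewrite mulr_sumr.
    by apply: eq_bigr => i _; rewrite mulrA.
move=> f0; change (comb f); rewrite (mpolyE f); apply: ideal_sum_mem => // m mf.
have [|i mi] := @mnm_neq0 m.
  by apply: contraTneq mf => ->; rewrite mcoeff_msupp f0 eqxx.
have -> : m = (m - U_(i) + U_(i))%MM.
  rewrite submK //; apply/mnm_lepP => j; rewrite mnm1E.
  by case: eqVneq => // <-.
rewrite mpolyXD scalerAl; apply: idealM => //.
exists (fun j => (j == i :> nat)%:R); rewrite (bigD1 i) //= eqxx mul1r mvar_ord.
rewrite big1 ?addr0 // => j ji; rewrite val_eqE (negPf ji).
by rewrite mul0r.
Qed.

End MPolyIdeals.

(** * Depth read off the Koszul complex *)

Lemma nat_maxP (P : nat -> Prop) v :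
  P v -> (forall m, P m -> (m <= v)%N) -> nat_max P = v.
Proof.
move=> Pv maxv; have : exists v, P v /\ forall m, P m -> (m <= v)%N by exists v.
move=> /(epsilon_spec (inhabits 0%N)); rewrite -/(nat_max P) => -[Pm maxm].
by apply/eqP; rewrite eqn_leq maxv //= maxm.
Qed.

(** Downward closure makes the maximum a threshold; depths and grades are always
    compared in this form. *)
Lemma nat_max_le (P : nat -> Prop) b : (forall r s, (r <= s)%N -> P s -> P r) ->
  P 0%N -> (forall r, P r -> (r <= b)%N) ->
  forall r, P r <-> (r <= nat_max P)%N.
Proof.
move=> Pdown P0 bP.
have [v [Pv maxv]] : exists v, P v /\ forall m, P m -> (m <= v)%N.
  elim: b bP => [|b IH] bP; first by exists 0%N.
  case: (classic (P b.+1)) => [Pb|nPb]; first by exists b.+1.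
  apply: IH => r Pr; have := bP r Pr; rewrite leq_eqVlt => /predU1P[rb|//].
  by case: nPb; rewrite -rb.
rewrite (nat_maxP Pv maxv) => r; split=> [/maxv //|/Pdown]; exact.
Qed.

Section Depth.
Variables (K : fieldType) (n : nat).
Local Notation T := {mpoly K[n]}.
Local Notation vanish := (kvanish (@mvar K n) n).
Variable L : T -> Prop.
Hypotheses (idL : is_ideal L) (Lirr : forall f, L f -> irrelevant f).

Let weakly_regular s := forall (i : nat) (f : T), (i < size s)%N ->
    ideal_adjoin L (take i s) (s`_i * f) -> ideal_adjoin L (take i s) f.

(** By iteration of [kvanish_adjoin1] along the sequence. *)
Lemma kvanish_regular s p : (forall f, f \in s -> irrelevant f) ->
  weakly_regular s -> vanish L p <-> vanish (ideal_adjoin L s) (p + size s)%N.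
Proof.
move=> sirr regs; suff H i : (i <= size s)%N ->
    vanish L p <-> vanish (ideal_adjoin L (take i s)) (p + i)%N.
  by have := H _ (leqnn _); rewrite take_size.
elim: i => [|i IH] i_s.
  rewrite take0 addn0; split; apply: kvanish_ext => f;
  by split=> /(ideal_adjoin_nil _ idL).
rewrite IH 1?ltnW // addnS (take_nth 0) //.
have [a Ha] := irrelevant_comb (sirr _ (mem_nth 0 i_s)).
rewrite (kvanish_adjoin1 (ideal_gen_ideal _) _ Ha); last by move=> h; apply: regs.
by split; apply: kvanish_ext => f; split=> /(ideal_adjoin_rcons _ _ _ idL).
Qed.

Lemma adjoin_irrelevant s : (forall f, f \in s -> irrelevant f) ->
  forall f, ideal_adjoin L s f -> irrelevant f.
Proof.
move=> sirr; apply: ideal_gen_sub; first exact: irrelevant_ideal.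
by move=> f [/Lirr|/sirr].
Qed.

(** The vanishing range after a regular sequence of length i < r starts at most at
    n, so the top homology vanishes there and the sequence can be extended. *)
Lemma regular_seq_exists r : (exists s : seq T,
    [/\ size s = r, forall f, f \in s -> irrelevant f & regular_seq L s]) <->
  (r <= n.+1)%N /\ vanish L (n.+1 - r)%N.
Proof.
split=> [[s [<- sirr [nL1 regs]]]|].
  have V : vanish L (n.+1 - size s)%N.
    apply/(kvanish_regular _ sirr regs).
    apply: kvanish_gt; first exact: ideal_gen_ideal.
    by rewrite addnC -maxnE leq_max ltnSn orbT.
  split=> //; rewrite leqNgt; apply/negP => lt_s.
  apply: (@irrelevant1 K n).
  apply: (kvanish0 idL (@irrelevant_ideal K n) Lirr (x := @mvar K n) (n := n)).
    by move=> i _; apply: mvar_irrelevant.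
  by move: V; rewrite (_ : (n.+1 - size s)%N = 0%N) //; lia.
case=> rn V.
have [s [sr sirr regs]] : exists s : seq T,
    [/\ size s = r, forall f, f \in s -> irrelevant f & weakly_regular s].
  elim: r => [|r IH] in rn V *; first by exists [::].
  have [||s [sr sirr regs]] := IH; first exact: ltnW.
    by apply: kvanish_le V; lia.
  have idLs := ideal_gen_ideal (fun f => L f \/ f \in s).
  have [f [firr regf]] : exists f, irrelevant f /\
      forall h, ideal_adjoin L s (f * h) -> ideal_adjoin L s h.
    apply: regular_element_exists => //.
    - exact: noetherian_mpoly.
    - exact: irrelevant_ideal.
    move=> h Hh; apply: (kvanish_top (x := @mvar K n) (n := n) idLs) => [|i _].
      have := (kvanish_regular (n.+1 - r.+1)%N sirr regs).1 V.
      by rewrite sr subSS subnK.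
    by apply: Hh; apply: mvar_irrelevant.
  exists (rcons s f); split=> [|g|i g]; first by rewrite size_rcons sr.
    by rewrite mem_rcons inE => /predU1P[->|/sirr].
  rewrite size_rcons ltnS leq_eqVlt => /predU1P[->|i_s].
    rewrite nth_rcons ltnn eqxx -cats1 take_size_cat //; exact: regf.
  by rewrite nth_rcons i_s -cats1 takel_cat 1?ltnW //; apply: regs.
exists s; split=> //; split=> // /(adjoin_irrelevant sirr).
exact: irrelevant1.
Qed.

(** With n + 1 - r for the first vanishing degree: vanishing from n + 1 on is
    automatic, and a regular sequence of length r moves it to this place. *)
Lemma depth_quotP r :
  (r <= depth_quot L)%N <-> (r <= n.+1)%N /\ vanish L (n.+1 - r)%N.
Proof.
rewrite -regular_seq_exists; symmetry.
apply: (@nat_max_le _ n.+1) => [r1 r2 r12|| {}r].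
- move=> /regular_seq_exists[r2n V]; apply/regular_seq_exists.
  by split; [lia | apply: kvanish_le V; lia].
- by apply/regular_seq_exists; split=> //; apply: kvanish_gt => //; lia.
- by case/regular_seq_exists.
Qed.

End Depth.

(** * Adjoining a variable as a mapping cone *)

Lemma eq_kD (R : comNzRingType) (x y : nat -> R) n :
  (forall i, (i < n)%N -> x i = y i) -> kD x n = kD y n.
Proof.
elim: n => //= n IH xy; rewrite xy // IH // => i i_n.
by apply: xy; rewrite ltnW.
Qed.

Section Transport.
Variables (R S : comNzRingType) (phi : {rmorphism R -> S}).

Lemma map_kD x n : map_mx phi (kD x n) = kD (phi \o x) n.
Proof.
by elim: n => [|n IH] /=; rewrite ?map_mx0 // map_block_mx map_mxN IH map_scalar_mx map_mx0.
Qed.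

Lemma map_kQ n p : map_mx phi (kQ R n p) = kQ S n p.
Proof.
elim: n p => [|n IH] p /=; first by rewrite map_scalar_mx rmorph_nat.
by rewrite map_block_mx !IH map_mx0.
Qed.

(** Lets the Koszul complex over K[x1, ..., xn, x] be studied over K[x1, ..., xn][X]. *)
Lemma kvanish_iso (psi : S -> R) n x (y : nat -> S) (L : R -> Prop) (M : S -> Prop) p :
    cancel phi psi -> cancel psi phi ->
    (forall i, (i < n)%N -> phi (x i) = y i) -> (forall f, L f <-> M (phi f)) ->
  kvanish x n L p <-> kvanish y n M p.
Proof.
move=> phiK psiK phix LM.
have mapK m k (A : 'M[S]_(m, k)) : map_mx phi (map_mx psi A) = A.
  by rewrite -map_mx_comp (eq_map_mx _ psiK) map_mx_id.
have LMmx m k (A : 'M[R]_(m, k)) : mx_in L A <-> mx_in M (map_mx phi A).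
  by split=> H i j; have := H i j; rewrite mxE LM.
rewrite /kvanish; have <- : map_mx phi (kD x n) = kD y n by rewrite map_kD; exact: eq_kD phix.
have phimx_inj m k : injective (@map_mx R S phi m k).
  by move=> A B /matrixP AB; apply/matrixP=> i j; have := AB i j; rewrite !mxE => /(can_inj phiK).
split=> V z Qz Lz.
  have [||w Hw] := V (map_mx psi z).
  - by apply: phimx_inj; rewrite map_mxM mapK map_kQ.
  - by rewrite LMmx map_mxM mapK.
  by exists (map_mx phi w); rewrite -[z]mapK -map_mxM -map_mxB -LMmx.
have [||w Hw] := V (map_mx phi z).
- by rewrite -map_kQ -map_mxM Qz.
- by rewrite -map_mxM -LMmx.
by exists (map_mx psi w); rewrite LMmx map_mxB map_mxM mapK.
Qed.

End Transport.

Section Cone.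
Variables (R : comNzRingType) (n : nat) (x : nat -> R) (y : nat -> {poly R}).
Hypotheses (yx : forall i, (i < n)%N -> y i = (x i)%:P) (yn : y n = 'X).
Variables L1 L0 : R -> Prop.
Hypotheses (idL1 : is_ideal L1) (idL0 : is_ideal L0).
Hypothesis L10 : forall f, L1 f -> L0 f.

(** The ideal L1 + X L0[X] of R[X]. *)
Definition poly_ideal (f : {poly R}) := L1 f`_0 /\ forall t, L0 f`_t.+1.

Lemma poly_ideal_ideal : is_ideal poly_ideal.
Proof.
split=> [|f g [f0 fS] [g0 gS]|a f [f0 fS]].
- by split=> [|t]; rewrite coef0; apply: ideal0.
- by split=> [|t]; rewrite coefD; apply: idealD.
split=> [|t]; first by rewrite coefM big_ord1; apply: idealM.
rewrite coefM; apply: ideal_sum => // i _; apply: idealM => //.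
by case: (_ - _)%N => // ; apply: L10.
Qed.

Let cmx t m k (A : 'M[{poly R}]_(m, k)) : 'M[R]_(m, k) := map_mx (coefp t) A.
Let C m k (A : 'M[R]_(m, k)) : 'M[{poly R}]_(m, k) := map_mx polyC A.

Let cmxD t m k (A B : 'M_(m, k)) : cmx t (A + B) = cmx t A + cmx t B.
Proof. exact: map_mxD. Qed.

Let cmxN t m k (A : 'M_(m, k)) : cmx t (- A) = - cmx t A.
Proof. exact: map_mxN. Qed.

Let cmx0 t m k : cmx t (0 : 'M_(m, k)) = 0.
Proof. exact: map_mx0. Qed.

Let cmx_X0 m k (A : 'M_(m, k)) : cmx 0 ('X *: A) = 0.
Proof. by apply/matrixP=> i j; rewrite !mxE /= coefXM. Qed.

Let cmx_XS t m k (A : 'M_(m, k)) : cmx t.+1 ('X *: A) = cmx t A.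
Proof. by apply/matrixP=> i j; rewrite !mxE /= coefXM. Qed.

Let cmx_C0 m k (A : 'M_(m, k)) : cmx 0 (C A) = A.
Proof. by apply/matrixP=> i j; rewrite !mxE /= coefC. Qed.

Let cmx_CS t m k (A : 'M_(m, k)) : cmx t.+1 (C A) = 0.
Proof. by apply/matrixP=> i j; rewrite !mxE /= coefC. Qed.

Let cmx_CM t m k l (A : 'M_(m, k)) (B : 'M_(k, l)) : cmx t (C A *m B) = A *m cmx t B.
Proof.
apply/matrixP=> i j; rewrite !mxE /= coef_sum; apply: eq_bigr => h _.
by rewrite !mxE /= coefCM.
Qed.

Let polymx m k (A : 'M_(m, k)) :
  mx_in poly_ideal A <-> mx_in L1 (cmx 0 A) /\ forall t, mx_in L0 (cmx t.+1 A).
Proof.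
split=> [H|[H0 HS] i j]; last first.
  by split=> [|t]; [have := H0 i j | have := HS t i j]; rewrite mxE.
by split=> [|t] i j; have [A0 AS] := H i j; rewrite mxE; [apply: A0 | apply: AS].
Qed.

Let kDC : kD y n = C (kD x n).
Proof. by rewrite /C map_kD; apply: eq_kD => i /yx ->. Qed.

Let kQC p : kQ _ n p = C (kQ _ n p).
Proof. by rewrite /C map_kQ. Qed.

Let kQ_cmx p t (A : 'cV[{poly R}]_(kdim n)) :
  kQ _ n p *m A = A -> kQ _ n p *m cmx t A = cmx t A.
Proof. by move=> QA; rewrite -cmx_CM -kQC QA. Qed.

Let kD_col (a b : 'cV_(kdim n)) :
  kD y n.+1 *m col_mx a b = col_mx (C (kD x n) *m a + 'X *: b) (- (C (kD x n) *m b)).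
Proof. by rewrite /= mul_block_col yn kDC mul_scalar_mx mul0mx add0r mulNmx. Qed.

Let kQ_col p (a b : 'cV[{poly R}]_(kdim n)) : kQ _ n.+1 p *m col_mx a b = col_mx a b <->
  kQ _ n p *m a = a /\ kQ _ n p.-1 *m b = b.
Proof.
rewrite /= mul_block_col !mul0mx addr0 add0r; split=> [/eq_col_mx //|[-> ->] //].
Qed.

Let kQ_C p (A : 'cV_(kdim n)) : kQ _ n p *m A = A -> kQ _ n p *m C A = C A.
Proof. by move=> QA; rewrite kQC -map_mxM QA. Qed.

Let kcol_split (z : 'cV[{poly R}]_(kdim n.+1)) :
  exists a b : 'cV[{poly R}]_(kdim n), z = col_mx a b.
Proof. by exists (usubmx z), (dsubmx z); rewrite vsubmxK. Qed.

(** Given a cycle (a, b), the parts b_0 and a_0 are boundaries of some u_0 and w_0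
    modulo L1; then a_1 + u_0 is a cycle, hence the boundary of some w_1, modulo
    L0.  In
    X-degrees above 1 the cone is that of an identity map: the part a_(t+1)
    itself can serve as lower component in degree t. *)
Lemma kvanish_cone p :
  kvanish x n L1 p -> kvanish x n L0 p.+1 -> kvanish y n.+1 poly_ideal p.+1.
Proof.
move=> V1 V0 z; have [a [b ->]] := kcol_split z.
rewrite kQ_col kD_col mx_in_col => -[Qa /= Qb] [/polymx[La0 LaS] /polymx[Lb0 LbS]].
have [||u0 [Qu0 Hu0]] := kvanish_supp idL1 V1 (z := cmx 0 b).
- exact: kQ_cmx.
- by move: Lb0; rewrite cmxN cmx_CM => /(mx_inN idL1); rewrite opprK.
have [||w0 Hw0] := kvanish_le (leqnSn p) V1 (z := cmx 0 a).
- exact: kQ_cmx.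
- by move: La0; rewrite cmxD cmx_CM cmx_X0 addr0.
have [||w1 Hw1] := V0 (cmx 1 a + u0).
- by rewrite mulmxDr (kQ_cmx _ Qa) Qu0.
- have := mx_inB idL0 (LaS 0%N) (fun i j => L10 (Hu0 i j)).
  by rewrite cmxD cmx_XS cmx_CM opprB addrACA subrr addr0 -mulmxDr.
have [u [cu0 cuS]] : exists u, cmx 0 u = - u0 /\ forall t, cmx t.+1 u = cmx t.+2 a.
  exists (C (- u0) + 'X *: map_mx (drop_poly 2) a).
  split=> [|t]; first by rewrite cmxD cmx_C0 cmx_X0 addr0.
  rewrite cmxD cmx_CS add0r cmx_XS; apply/matrixP => i j.
  by rewrite !mxE /= coef_drop_poly addn2.
have [w [cw0 [cw1 cwS]]] : exists w, cmx 0 w = w0 /\ cmx 1 w = w1 /\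
    forall t, cmx t.+2 w = 0.
  exists (C w0 + 'X *: C w1); rewrite !cmxD cmx_C0 cmx_X0 addr0.
  by rewrite cmx_CS add0r cmx_XS cmx_C0; split=> //; split=> // t;
    rewrite cmxD cmx_XS !cmx_CS addr0.
exists (col_mx w u); rewrite kD_col opp_col_mx add_col_mx mx_in_col !polymx.
split; split=> [|t]; rewrite !(cmxD, cmxN, cmx_CM, cmx_X0, cmx_XS).
- by rewrite cw0 addr0; exact: Hw0.
- case: t => [|t]; first by rewrite cw1 cu0 opprD opprK addrA addrAC.
  by rewrite cwS cuS mulmx0 add0r subrr; apply: mx_in0.
- by rewrite cu0 mulmxN !opprK.
- by rewrite cuS opprK addrC; have := LaS t.+1; rewrite cmxD cmx_CM cmx_XS.
Qed.

Hypothesis exactness : kvanish x n (fun f => f = 0) 1.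
Hypothesis cycles_bound : forall z : 'cV_(kdim n), mx_in L1 (kD x n *m z) ->
  exists b, mx_in L0 b /\ kD x n *m z = kD x n *m b.

(** The projection from the complex modulo L1 to the complex modulo L0 is zero on
    homology in positive degrees. *)
Let split_cycle p (u : 'cV_(kdim n)) : (0 < p)%N -> kQ _ n p *m u = u ->
  mx_in L1 (kD x n *m u) ->
  exists c b, [/\ kQ _ n p.+1 *m c = c, mx_in L0 b & u = kD x n *m c + b].
Proof.
case: p => // p _ Qu /cycles_bound[b [Lb Db]].
have id0 : is_ideal (fun f : R => f = 0).
  by split=> [//|f g -> ->|a f ->]; rewrite ?addr0 ?mulr0.
have [||c [Qc Hc]] := kvanish_supp id0 (kvanish_le (ltn0Sn p) exactness)
  (z := u - kQ _ n p.+1 *m b).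
- by rewrite mulmxBr kQ_id Qu.
- move=> i j; rewrite mulmxBr mulmxA -kQD -mulmxA -Db mulmxA kQD -mulmxA Qu.
  by rewrite subrr mxE.
exists c, (kQ _ n p.+1 *m b); split=> //; first exact: mx_inMl.
apply/eqP; rewrite -subr_eq0 opprD addrA addrAC; apply/eqP/matrixP=> i j.
by rewrite Hc mxE.
Qed.

(** A cycle z modulo L1 is the boundary of some c modulo L0, so (- X c, z) is a
    cycle of the cone; that it is a boundary says in X-degree 0 that z is one
    modulo L1.  For a cycle z modulo L0 take (X z, 0): in X-degree 1 it shows z
    to be a boundary up to some u_0 that is a cycle modulo L1, hence itself a
    boundary modulo L0. *)
Lemma kvanish_cone_inv p : (0 < p)%N -> kvanish y n.+1 poly_ideal p.+1 ->
  kvanish x n L1 p /\ kvanish x n L0 p.+1.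
Proof.
move=> p0 V; split=> z Qz Lz.
  have [c [b [Qc Lb def_z]]] := split_cycle p0 Qz Lz.
  have [||w] := V (col_mx (- ('X *: C c)) (C z)).
  - by apply/kQ_col; rewrite mulmxN -scalemxAr !kQ_C.
  - rewrite kD_col mx_in_col !polymx; split; split=> [|t].
    + by rewrite cmxD cmx_CM cmxN !cmx_X0 oppr0 mulmx0 addr0; apply: mx_in0.
    + rewrite cmxD cmx_CM cmxN !cmx_XS; case: t => [|t].
        by rewrite !cmx_C0 def_z mulmxN addKr.
      by rewrite !cmx_CS oppr0 mulmx0 addr0; apply: mx_in0.
    + by rewrite cmxN cmx_CM cmx_C0; apply: mx_inN.
    + by rewrite cmxN cmx_CM cmx_CS mulmx0 oppr0; apply: mx_in0.
  have [w1 [w2 ->]] := kcol_split w.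
  rewrite kD_col opp_col_mx add_col_mx mx_in_col !polymx => -[_ [H _]].
  exists (- cmx 0 w2); move: H.
  by rewrite cmxD !cmxN cmx_CM cmx_C0 mulmxN.
have [||w [Qw]] := kvanish_supp poly_ideal_ideal V
  (z := col_mx ('X *: C z) 0 : 'cV_(kdim n.+1)).
- by apply/kQ_col; rewrite -scalemxAr !kQ_C // mulmx0.
- rewrite kD_col mx_in_col !polymx; split; split=> [|t].
  + by rewrite cmxD cmx_CM !cmx_X0 mulmx0 addr0; apply: mx_in0.
  + rewrite cmxD cmx_CM !cmx_XS cmx0 addr0; case: t => [|t].
      by rewrite cmx_C0.
    by rewrite cmx_CS mulmx0; apply: mx_in0.
  + by rewrite mulmx0 oppr0 cmx0; apply: mx_in0.
  + by rewrite mulmx0 oppr0 cmx0; apply: mx_in0.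
have [w1 [u def_w]] := kcol_split w; move: Qw; rewrite def_w.
rewrite kQ_col kD_col opp_col_mx add_col_mx mx_in_col !polymx => -[_ /= Qu].
case=> [[_ /(_ 0%N) H0] [H1 _]].
have [|c [b [Qc Lb def_u]]] := split_cycle (ltn0Sn p) (kQ_cmx 0 Qu).
  by move: H1; rewrite cmxD !cmxN cmx_CM opprK cmx0 add0r.
exists (cmx 1 w1 + c); have := mx_inD idL0 H0 Lb.
rewrite cmxD cmxN cmxD !cmx_XS cmx_C0 cmx_CM def_u mulmxDr.
by rewrite !opprD !addrA subrK.
Qed.

End Cone.

(** * Monomial ideals and monomial regular sequences *)

Section MonomialIdeals.
Variables (K : fieldType) (n : nat).
Local Notation T := {mpoly K[n]}.
Implicit Types (A : 'X_{1..n} -> Prop) (m a b : 'X_{1..n}) (ms : seq 'X_{1..n}).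

Definition monomial_span A : T -> Prop := ideal_gen (fun g => exists2 m, A m & g = 'X_[m]).

Lemma ideal_lem (L : T -> Prop) a m : is_ideal L -> (a <= m)%MM -> L 'X_[a] -> L 'X_[m].
Proof. by move=> idL /submK<- La; rewrite mpolyXD; apply: (idealM idL). Qed.

Lemma monomial_spanP A f : monomial_span A f <->
  forall m, m \in msupp f -> exists a, A a /\ (a <= m)%MM.
Proof.
have idA : is_ideal (monomial_span A) by apply: ideal_gen_ideal.
split=> [|H].
  move: f; apply: ideal_gen_sub => [|_ [a Aa ->] m]; last first.
    by rewrite msuppX inE => /eqP->; exists a; rewrite lepm_refl.
  split=> [m|f g Hf Hg m|f g Hg m]; first by rewrite msupp0.
    by move/msuppD_le; rewrite mem_cat => /orP[/Hf|/Hg].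
  case/msuppM_le/allpairsP=> -[m1 m2] /= [_ /Hg[a [Aa am]] ->].
  by exists a; split=> //; apply: lepm_trans am (lem_addl _ _).
rewrite (mpolyE f); apply: ideal_sum_mem => // m /H[a [Aa am]].
rewrite -mul_mpolyC; apply: (idealM idA); apply: ideal_lem am _ => //.
by apply: ideal_gen_mem; exists a.
Qed.

Lemma monomial_spanX A m : monomial_span A 'X_[m] <-> exists a, A a /\ (a <= m)%MM.
Proof.
rewrite monomial_spanP; split=> [|H m']; last by rewrite msuppX inE => /eqP->.
by apply; rewrite msuppX mem_head.
Qed.

Lemma monomial_span_supp A f :
  monomial_span A f <-> forall m, m \in msupp f -> monomial_span A 'X_[m].
Proof.
by rewrite monomial_spanP; split=> H m mf; have := H m mf; rewrite monomial_spanX.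
Qed.

Lemma adjoin_monomials ms f : ideal_adjoin (fun f : T => f = 0) [seq 'X_[m] | m <- ms] f <->
  monomial_span (fun m => m \in ms) f.
Proof.
split.
  apply: ideal_gen_sub; first exact: ideal_gen_ideal.
  move=> g [->|/mapP[m mms ->]]; first exact: (ideal0 (ideal_gen_ideal _)).
  by apply: ideal_gen_mem; exists m.
apply: ideal_gen_mono => _ [m mms ->]; right; exact: map_f.
Qed.

Definition mdisjoint m1 m2 := [forall i, (m1 i == 0%N) || (m2 i == 0%N)].

Lemma mdisjoint_le a b m : mdisjoint b a -> (b <= a + m)%MM -> (b <= m)%MM.
Proof.
move=> /forallP ba /mnm_lepP bam; apply/mnm_lepP => i.
have := bam i; rewrite mnmDE; case/orP: (ba i) => /eqP->; first by rewrite leq0n.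
by rewrite add0n.
Qed.

(** Modulo a monomial ideal, multiplication by a monomial can only fail to be
    injective if the monomial shares a variable with a generator. *)
Lemma mdisjoint_regular ms (i : nat) (f : T) : pairwise mdisjoint ms ->
  (i < size ms)%N ->
  ideal_adjoin (fun f => f = 0) (take i [seq 'X_[m] | m <- ms]) ([seq 'X_[m] | m <- ms]`_i * f) ->
  ideal_adjoin (fun f => f = 0) (take i [seq 'X_[m] | m <- ms]) f.
Proof.
move=> disj i_ms; rewrite -map_take !adjoin_monomials (nth_map 0%MM) // !monomial_spanP.
move=> H m mf; have [|b [bms bm]] := H (nth 0%MM ms i + m)%MM.
  by rewrite mcoeff_msupp mulrC mcoeffMX -mcoeff_msupp.
exists b; split=> //; apply: mdisjoint_le bm.
have [j j_i <-] := nthP 0%MM bms; rewrite size_take i_ms in j_i.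
rewrite nth_take //; apply/(pairwiseP 0%MM) => //; exact: ltn_trans i_ms.
Qed.

(** If two monomials a and b of the sequence, a before b, have a common divisor
    c <> 1, then a / c is killed by b modulo a, so it must lie in the ideal of
    the monomials before b.  Being a proper divisor of a, it is not a multiple
    of a, and it is not a multiple of another one either, as those are already
    known to be disjoint from a. *)
Lemma regular_monomials ms :
  regular_seq (fun f : T => f = 0) [seq 'X_[m] | m <- ms] <->
  0%MM \notin ms /\ pairwise mdisjoint ms.
Proof.
have unit_ideal : ideal_adjoin (fun f : T => f = 0) [seq 'X_[m] | m <- ms] 1 <-> 0%MM \in ms.
  rewrite adjoin_monomials -mpolyX0 monomial_spanX.
  split=> [[a [ams a0]]|ms0]; last by exists 0%MM; rewrite lepm_refl.
  suff <- : a = 0%MM by [].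
  by apply/mnmP => i; move/mnm_lepP: a0 => /(_ i); rewrite mnm0E leqn0 => /eqP.
rewrite /regular_seq unit_ideal size_map; split=> [[/negP ms0 reg]|[/negP ms0 disj]]; last first.
  by split=> // i f i_ms; apply: mdisjoint_regular.
split=> //; apply/(pairwiseP 0%MM) => i j _ j_ms ij; move: i ij; rewrite inE in j_ms.
elim/ltn_ind: j j_ms => j IH j_ms i ij; apply/forallP => v.
set a := nth _ _ i; set b := nth _ _ j.
rewrite -leqn0 -[X in _ || X]leqn0 -geq_min leqn0; apply: contraT => ab.
(* The greatest common divisor of a and b. *)
pose c := [multinom minn (a v) (b v) | v < n].
have ca : (c <= a)%MM by apply/mnm_lepP => w; rewrite mnmE geq_minl.
have [l lj Hl] : exists2 l, (l < j)%N & (nth 0%MM ms l <= a - c)%MM.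
  have := reg j ('X_[a - c] : T) j_ms.
  rewrite -map_take !adjoin_monomials (nth_map 0%MM) // -mpolyXD !monomial_spanX.
  case=> [|d [dms dac]].
    exists a; split.
      by rewrite /a -(nth_take 0%MM ij) mem_nth // size_take j_ms.
    apply/mnm_lepP => w; rewrite mnmDE mnmBE mnmE -/b; lia.
  have [l l_j def_d] := nthP 0%MM dms; rewrite size_take j_ms in l_j.
  by exists l => //; rewrite -(nth_take 0%MM l_j) def_d.
have i_ms : (i < size ms)%N by apply: ltn_trans j_ms.
have l_ms : (l < size ms)%N by apply: ltn_trans j_ms.
have [il|li|il] := ltngtP i l.
- suff l0 : nth 0%MM ms l = 0%MM by case: ms0; rewrite -l0 mem_nth.
  apply/mnmP => w; rewrite mnm0E; apply/eqP; rewrite -leqn0.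
  have /forallP/(_ w) := IH l lj l_ms i il.
  move/mnm_lepP: Hl => /(_ w); rewrite mnmBE -/a; lia.
- suff l0 : nth 0%MM ms l = 0%MM by case: ms0; rewrite -l0 mem_nth.
  apply/mnmP => w; rewrite mnm0E; apply/eqP; rewrite -leqn0.
  have /forallP/(_ w) := IH i ij i_ms l li.
  move/mnm_lepP: Hl => /(_ w); rewrite mnmBE -/a; lia.
- move/mnm_lepP: Hl => /(_ v); rewrite mnmBE -il -/a mnmE; lia.
Qed.

End MonomialIdeals.

Arguments mdisjoint {n}.

Section Exactness.
Variables (K : fieldType) (n : nat).
Local Notation T := {mpoly K[n]}.

Lemma zero_ideal : is_ideal (fun f : T => f = 0).
Proof. by split=> [//|f g -> ->|a f ->]; rewrite ?addr0 ?mulr0. Qed.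

(** The variables form a regular sequence of length n, so vanishing from degree 1
    on is equivalent to vanishing from degree n + 1 on, which is automatic. *)
Lemma koszul_exact_pos : kvanish (@mvar K n) n (fun f => f = 0) 1.
Proof.
pose ms := [seq U_(i)%MM | i <- enum 'I_n].
have szms : size ms = n by rewrite size_map size_enum_ord.
apply/(kvanish_regular zero_ideal (s := [seq 'X_[m] | m <- ms]) 1).
- by move=> _ /mapP[_ /mapP[i _ ->] ->]; apply/irrelevantX; rewrite mnm1_eq0.
- move=> i f; rewrite size_map => i_ms; apply: mdisjoint_regular => //.
  have := enum_uniq 'I_n; rewrite /ms; elim: (enum 'I_n) => //= j s IH /andP[j_s /IH->].
  rewrite andbT all_map; apply/allP => k k_s; apply/forallP => l.
  by rewrite !mnm1E; case: (eqVneq j l) => [<-|//]; rewrite (negPf (memPn j_s k k_s)).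
- by rewrite size_map szms; apply: kvanish_gt; [apply: ideal_gen_ideal|].
Qed.

(** In degree 0 the cokernel is the residue field: a component without constant
    term is a boundary, by the homotopy for it. *)
Lemma koszul_exact (z : 'cV[T]_(kdim n)) : kD (@mvar K n) n *m z = 0 ->
  mx_in (@irrelevant K n) z -> exists w, z = kD (@mvar K n) n *m w.
Proof.
move=> Dz irrz; have [i Hi] := kQ1_compl z.
have [a def_zi] := irrelevant_comb (irrz i 0).
have [h [Hh _]] := koszul_homotopy (@mvar K n) n a.
have Dh : kD (@mvar K n) n *m (h *m kbot T n) = z i 0 *: kbot T n.
  rewrite def_zi -[RHS]mul_scalar_mx -Hh mulmxDl -!mulmxA kD_bot mulmx0 add0r.
  by rewrite mulmxA.
have [||w Hw] := koszul_exact_pos (z := kQ T n 1 *m z).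
- exact: kQ_id.
- move=> j k; have -> : kQ T n 1 *m z = z - kD (@mvar K n) n *m (h *m kbot T n).
    by rewrite Dh -Hi opprB addrC subrK.
  by rewrite mulmxBr Dz (mulmxA (kD _ n) (kD _ n)) kD_sq mul0mx subr0 mxE.
have Q1z : kQ T n 1 *m z = kD (@mvar K n) n *m w.
  apply/eqP; rewrite -subr_eq0; apply/eqP/matrixP=> j k.
  by rewrite Hw mxE.
by exists (w + h *m kbot T n); rewrite mulmxDr Dh -Hi -Q1z addrC subrK.
Qed.

End Exactness.

(** * Linear resolutions bound Koszul cycles *)

Section LinearResolution.
Variables (K : fieldType) (n : nat).
Local Notation T := {mpoly K[n]}.
Local Notation irr := (@irrelevant K n).
Local Notation D := (kD (@mvar K n) n).
Local Notation Q := (kQ T n).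
Let idirr := @irrelevant_ideal K n.

(** Multiplication by linear forms shifts homogeneous parts by one.  This is the
    only consequence of linearity that the double complex chase uses. *)
Lemma pihomog_linM d (p q : T) : p \is 1.-homog ->
  pihomog mdeg d.+1 (p * q) = p * pihomog mdeg d q.
Proof.
move=> p1; set k := maxn d.+1 (mmeasure mdeg q).
rewrite {1}(@pihomog_partitionE _ _ mdeg k q) ?leq_maxr // mulr_sumr raddf_sum /=.
have d_k : (d < k)%N by rewrite leq_maxl.
have pe e : p * pihomog mdeg e q \is e.+1.-homog.
  by rewrite -add1n; apply: dhomogM => //; apply: pihomogP.
rewrite (bigD1 (Ordinal d_k)) //= pihomog_dE // big1 ?addr0 // => e ne.
by apply: pihomog_ne0 (pe e); rewrite eqSS.
Qed.

Lemma pihomog0_irr (f : T) : irr f -> pihomog mdeg 0 f = 0.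
Proof.
move=> f0; rewrite pihomogE big_seq_cond big1 // => m /andP[_].
by rewrite mdeg_eq0 => /eqP->; rewrite f0 scale0r.
Qed.

Lemma irr_pihomog0 (f : T) : irr (f - pihomog mdeg 0 f).
Proof.
set k := (mmeasure mdeg f).+1.
rewrite {1}(@pihomog_partitionE _ _ mdeg k f) // big_ord_recl /= addrAC subrr add0r.
apply: ideal_sum => // i _; apply: (@dhomog_nemf_coeff _ _ mdeg i.+1).
  exact: pihomogP.
by rewrite /= mdeg0.
Qed.

Lemma irr_lin (f : T) : f \is 1.-homog -> irr f.
Proof. by move=> f1; apply: (dhomog_nemf_coeff f1); rewrite /= mdeg0. Qed.

Local Notation hom d A := (map_mx (pihomog mdeg d) A).

Lemma hom_linM d m k l (A : 'M[T]_(m, k)) (B : 'M[T]_(k, l)) :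
  (forall i j, A i j \is 1.-homog) -> hom d.+1 (A *m B) = A *m hom d B.
Proof.
move=> A1; apply/matrixP=> i j; rewrite !mxE raddf_sum; apply: eq_bigr => h _.
by rewrite [in RHS]mxE; apply: pihomog_linM.
Qed.

Lemma hom_Mlin d m k l (A : 'M[T]_(m, k)) (B : 'M[T]_(k, l)) :
  (forall i j, B i j \is 1.-homog) -> hom d.+1 (A *m B) = hom d A *m B.
Proof.
move=> B1; apply/matrixP=> i j; rewrite !mxE raddf_sum; apply: eq_bigr => h _.
by rewrite mxE /= mulrC pihomog_linM // mulrC.
Qed.

Lemma kD_lin m i j : kD (@mvar K n) m i j \is 1.-homog.
Proof.
elim: m i j => [|m IH] i j /=; first by rewrite mxE dhomog0.
rewrite mxE; case: (split i) => i'; rewrite mxE; case: (split j) => j'.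
- exact: IH.
- rewrite mxE; case: (_ == _); rewrite ?mulr0n ?dhomog0 // mulr1n /mvar.
  by case: insub => [v|]; rewrite ?dhomog0 // dhomogX /= mdeg1.
- by rewrite mxE dhomog0.
- by rewrite mxE dhomogN; apply: IH.
Qed.

(** For a matrix A of a resolution, tensored with the Koszul complex: a Z with
    entries in the irrelevant ideal, concentrated in homological degrees below
    q, whose image in the next column of the double complex is a Koszul cycle,
    has the image of a boundary. *)
Definition cycles_lift b0 b1 (A : 'M[T]_(b1, b0)) q :=
  forall Z : 'M[T]_(kdim n, b1), Q q *m Z = 0 -> mx_in irr Z ->
    D *m Z *m A = 0 -> exists Y : 'M[T]_(kdim n, b1), Z *m A = D *m Y *m A.

(** One step of the chase.  As D Z is killed by A, it comes from some W through B.
    The entries of D Z have no part of degree 1 and B is linear, so the constant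
    part of W can be discarded, and so can its components in degrees from q on;
    then the hypotheses on Z pass to W, one degree lower.  If
    W B = D Y B, then Z - Y B is a Koszul cycle with entries in the irrelevant
    ideal, hence a boundary, and Z has the same image under A. *)
Lemma cycles_lift_step b0 b1 b2 (A : 'M[T]_(b1, b0)) (B : 'M[T]_(b2, b1)) q :
    (forall i j, B i j \is 1.-homog) ->
    (forall v : 'rV[T]_b1, v *m A = 0 <-> exists w, v = w *m B) ->
  cycles_lift B q -> cycles_lift A q.+1.
Proof.
move=> linB exactAB liftB Z QZ irrZ DZA.
have BA : B *m A = 0.
  apply/row_matrixP => i; rewrite row_mul row0; apply/exactAB.
  by exists (delta_mx 0 i); rewrite -rowE.
have [W DZ] : exists W, D *m Z = W *m B.
  have /fin_all_exists[W HW] i : exists w, row i (D *m Z) = w *m B.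
    by apply/exactAB; rewrite -row_mul DZA row0.
  exists (\matrix_i W i); apply/row_matrixP => i.
  by rewrite HW [in RHS]row_mul rowK.
have {}DZ : D *m Z = (W - hom 0 W) *m B.
  rewrite mulmxBl -DZ -hom_Mlin // -DZ hom_linM; last exact: kD_lin.
  have -> : hom 0 Z = 0 by apply/matrixP=> i j; rewrite !mxE pihomog0_irr.
  by rewrite mulmx0 subr0.
have irrW : mx_in irr (W - hom 0 W).
  by move=> i j; rewrite !mxE; apply: irr_pihomog0.
move: (W - hom 0 W) DZ irrW => {}W DZ irrW.
have {}DZ : D *m Z = (W - Q q *m W) *m B.
  by rewrite mulmxBl -mulmxA -DZ mulmxA kQD -mulmxA QZ mulmx0 subr0.
have {irrW} : mx_in irr (W - Q q *m W) by apply: mx_inB => //; apply: mx_inMl.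
have : Q q *m (W - Q q *m W) = 0 by rewrite mulmxBr kQ_id subrr.
move: (W - _) DZ => {}W DZ QW irrW.
have [|||Y WB] := liftB W => //.
  by rewrite -mulmxA -DZ mulmxA kD_sq mul0mx.
have irrB : mx_in irr B by move=> i j; apply: irr_lin.
have [U HU] : exists U, Z - Y *m B = D *m U.
  have /fin_all_exists[U HU] j : exists u, col j (Z - Y *m B) = D *m u.
    apply: koszul_exact.
      by rewrite colE mulmxA mulmxBr DZ WB mulmxA subrr mul0mx.
    move=> i k; rewrite mxE; apply: mx_inB => //; exact: mx_inMl.
  exists (\matrix_(i, j) U j i 0); apply/matrixP => i j.
  have /matrixP/(_ i 0) := HU j; rewrite mxE => ->; rewrite !mxE.
  by apply: eq_bigr => k _; rewrite mxE.
exists U; rewrite -HU mulmxBl -(mulmxA Y) BA mulmx0 subr0 //.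
Qed.

(** The chase ends because the Koszul complex lives in degrees at most n; its
    result is that cycles with entries in m N are boundaries of chains over N,
    where m is the irrelevant ideal. *)
Lemma linear_resolution_lift (N : T -> Prop) : linear_resolution N ->
  exists b (e : 'cV[T]_b), (forall f, N f <-> exists v : 'rV[T]_b, f = (v *m e) 0 0) /\
    forall Z : 'M[T]_(kdim n, b), mx_in irr Z -> D *m (Z *m e) = 0 ->
      exists y, mx_in N y /\ Z *m e = D *m y.
Proof.
case=> d [s [b [e [phi [_ [_ [lin [genN [exact0 exactS]]]]]]]]].
exists (b 0%N), e; split=> // Z irrZ DZ.
have lift q i : cycles_lift (phi i) q.
  elim: q i => [|q IH] i.
    by move=> Y; rewrite kQ0 mul1mx => -> _ _; exists 0; rewrite mulmx0 !mul0mx.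
  exact: (cycles_lift_step (lin i.+1) (exactS i) (IH i.+1)).
have [|||Y ZY] := cycles_lift_step (lin 0%N) exact0 (lift n 0%N) (Z := Z) => //.
- by rewrite kQ_gt // mul0mx.
- by rewrite -mulmxA.
exists (Y *m e); split; last by rewrite ZY mulmxA.
move=> i j; apply/genN; exists (row i Y).
by rewrite -row_mul [RHS]mxE (ord1 j).
Qed.

End LinearResolution.

Section CyclesBound.
Variables (K : fieldType) (n : nat).
Local Notation T := {mpoly K[n]}.
Local Notation irr := (@irrelevant K n).
Local Notation D := (kD (@mvar K n) n).
Variables (L1 L0 : T -> Prop).
Hypotheses (idL1 : is_ideal L1) (idL0 : is_ideal L0).
Hypothesis L1_supp : forall f, L1 f -> forall m, m \in msupp f -> L1 'X_[m].
Hypothesis L1_m_L0 : forall m, L1 'X_[m] -> exists i, (0 < m i)%N /\ L0 'X_[m - U_(i)].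
Hypothesis cwlL0 : componentwise_linear L0.

(** The cycle D z is treated one degree at a time: its part of degree d + 1 has
    entries in L1, hence in m N for N the ideal generated by the part of degree
    d of L0, and N has a linear resolution. *)
Lemma componentwise_linear_cycles (z : 'cV[T]_(kdim n)) : mx_in L1 (D *m z) ->
  exists y, mx_in L0 y /\ D *m z = D *m y.
Proof.
move=> Lz; pose hom d (A : 'cV[T]_(kdim n)) := map_mx (pihomog mdeg d) A.
have [k Hk] : exists k, D *m z = \sum_(d < k) hom d (D *m z).
  pose size_entry i := mmeasure mdeg ((D *m z) i 0).
  exists (\max_i size_entry i); apply/colP => i; rewrite summxE.
  have : (size_entry i <= \max_i size_entry i)%N by apply: leq_bigmax.
  move=> /pihomog_partitionE {1}->.
  by apply: eq_bigr => d _; rewrite [RHS]mxE.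
have Lhom d : mx_in L1 (hom d (D *m z)).
  move=> i j; rewrite mxE pihomogE big_seq_cond; apply: ideal_sum => // m /andP[mf _].
  by rewrite -mul_mpolyC; apply: (idealM idL1); apply: L1_supp mf.
suff H (d : 'I_k) : exists y, mx_in L0 y /\ hom d (D *m z) = D *m y.
  have /fin_all_exists[y Hy] := H; exists (\sum_d y d); split.
    move=> i j; rewrite summxE; apply: ideal_sum => // d _.
    by case: (Hy d).
  by rewrite Hk mulmx_sumr; apply: eq_bigr => d _; case: (Hy d).
case: d => -[|d] _ /=.
  exists 0; split; first exact: mx_in0.
  rewrite mulmx0; apply/matrixP => i j; rewrite [LHS]mxE [RHS]mxE pihomog0_irr //.
  by apply: (mx_inMr (@irrelevant_ideal K n)) => k' l; apply/irr_lin/kD_lin.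
have [b [e [genN lift]]] := linear_resolution_lift (cwlL0 d).
have [Z [irrZ def_u]] : exists Z : 'M[T]_(kdim n, b),
    mx_in irr Z /\ hom d.+1 (D *m z) = Z *m e.
  have /fin_all_exists[Z HZ] i : exists v : 'rV[T]_b,
      mx_in irr v /\ hom d.+1 (D *m z) i 0 = (v *m e) 0 0.
    have : L1 (hom d.+1 (D *m z) i 0) by apply: Lhom.
    have : hom d.+1 (D *m z) i 0 \is d.+1.-homog by rewrite mxE; apply: pihomogP.
    move: (hom _ _ i 0) => g ghom Lg.
    pose irrN (f : T) := exists v : 'rV[T]_b, mx_in irr v /\ f = (v *m e) 0 0.
    have idv : is_ideal irrN.
      split=> [|_ _ [v [irrv ->]] [w [irrw ->]]|a _ [v [irrv ->]]].
      - exists 0; rewrite mul0mx mxE; split=> //.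
        by apply: mx_in0; apply: irrelevant_ideal.
      - exists (v + w); rewrite mulmxDl [in RHS]mxE; split=> //.
        by apply: mx_inD => //; apply: irrelevant_ideal.
      - exists (a *: v); rewrite -scalemxAl [in RHS]mxE; split=> //.
        by apply: mx_inZ => //; apply: irrelevant_ideal.
    suff : irrN g by [].
    rewrite (mpolyE g); apply: ideal_sum_mem => // m mg.
    rewrite -mul_mpolyC; apply: (idealM idv).
    have [j [mj L0m]] := L1_m_L0 (L1_supp Lg mg).
    have Um : (U_(j) <= m)%MM.
      by apply/mnm_lepP => l; rewrite mnm1E; case: eqVneq => // <-.
    have degm : mdeg (m - U_(j)) = d.
      have /= degm := dhomog_mf ghom mg; have /(congr1 mdeg) := submK Um.
      by rewrite mdegD mdeg1 degm addn1 => -[].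
    have /genN[v def_v] : ideal_gen (fun f => L0 f /\ f \is d.-homog) 'X_[m - U_(j)].
      by apply: ideal_gen_mem; split; rewrite // dhomogX /= degm.
    exists ('X_j *: v); split.
      move=> r s; rewrite mxE mulrC; apply: (idealM (@irrelevant_ideal K n)).
      by apply/irrelevantX; rewrite mnm1_eq0.
    by rewrite -scalemxAl mxE -def_v -mpolyXD addmC submK.
  exists (\matrix_i Z i); split=> [i j|]; first by rewrite mxE; case: (HZ i).
  apply/colP => i; have [_ ->] := HZ i.
  have {1}-> : Z i = row i (\matrix_i Z i) by rewrite rowK.
  by rewrite -row_mul mxE.
have [|y [Ny Dy]] := lift Z irrZ.
  by rewrite -def_u /hom hom_linM; [rewrite mulmxA kD_sq mul0mx | apply: kD_lin].
exists y; split; last by rewrite def_u.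
move=> i j; move: (Ny i j); apply: ideal_gen_sub => // f [] //.
Qed.

End CyclesBound.

(** * Squarefree powers and matchings *)

Section SquarefreePowers.
Variables (K : fieldType) (n : nat).
Local Notation T := {mpoly K[n]}.
Implicit Types (m a b : 'X_{1..n}) (ms : seq 'X_{1..n}).

Lemma sqfree_le a m : (a <= m)%MM -> sqfree_mon m -> sqfree_mon a.
Proof. by move=> /mnm_lepP am sqm i; apply: leq_trans (am i) (sqm i). Qed.

(** For the edge ideal of a graph these are the vertex sets of its k-matchings. *)
Definition matching (L : T -> Prop) k m := exists ms,
  [/\ size ms = k, forall a, a \in ms -> L 'X_[a], (\sum_(a <- ms) a)%MM = m & sqfree_mon m].

Variable L : T -> Prop.
Hypothesis sqfreeL : sqfree_monomial_ideal L.

Lemma sqfree_ideal : is_ideal L.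
Proof.
have [[A [_ LA]] _ _] := sqfreeL.
have idA := ideal_gen_ideal (fun g : T => exists2 m, A m & g = 'X_[m]).
split=> [|f g /LA Lf /LA Lg|a f /LA Lf]; apply/LA.
- exact: ideal0.
- exact: idealD.
- exact: idealM.
Qed.

Lemma sqfree_supp f : L f -> forall m, m \in msupp f -> L 'X_[m].
Proof.
have [[A [_ LA]] _ _] := sqfreeL.
by move=> /LA/monomial_span_supp H m /H/LA.
Qed.

(** Replacing monomials of L by squarefree divisors keeps supports disjoint and
    makes sums of exponents squarefree. *)
Lemma sqfree_root m : L 'X_[m] -> exists a, [/\ sqfree_mon a, L 'X_[a] & (a <= m)%MM].
Proof.
have [[A [sqA LA]] _ _] := sqfreeL.
move=> /LA/monomial_spanX[a [Aa am]]; exists a; split=> //; first exact: sqA.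
by apply/LA/monomial_spanX; exists a; rewrite lepm_refl.
Qed.

Lemma sqfree_neq0 a : L 'X_[a] -> a != 0%MM.
Proof.
move=> La; have [_ _ nL1] := sqfreeL; apply/eqP => a0; apply: nL1.
by rewrite -mpolyX0 -a0.
Qed.

Lemma ideal_powP k f : ideal_pow L k f <->
  monomial_span (fun m => exists ms,
    [/\ size ms = k, forall a, a \in ms -> L 'X_[a] & (\sum_(a <- ms) a)%MM = m]) f.
Proof.
elim: k f => [|k IH] f.
  split=> // _; apply/monomial_spanP => m _; exists 0%MM; split.
    by exists [::]; rewrite big_nil.
  by apply/mnm_lepP => i; rewrite mnm0E.
split.
  apply: ideal_gen_sub; first exact: ideal_gen_ideal.
  move=> _ [g [h [Lg /IH/monomial_spanP Hh ->]]]; apply/monomial_spanP => m.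
  case/msuppM_le/allpairsP=> -[m1 m2] /= [/(sqfree_supp Lg) Lm1 /Hh[b [[ms [sz Lms <-]] bm]] ->].
  exists (m1 + \sum_(a <- ms) a)%MM; split.
    exists (m1 :: ms); rewrite big_cons /= sz; split=> // a.
    by rewrite inE => /predU1P[->|/Lms].
  by apply/mnm_lepP => i; rewrite !mnmDE leq_add2l; apply/mnm_lepP.
apply: ideal_gen_sub; first exact: ideal_gen_ideal.
move=> _ [m [[|a ms] [//= [sz] Lms <-]] ->].
apply: ideal_gen_mem; exists 'X_[a], 'X_[\sum_(a <- ms) a]; split.
- by apply: Lms; rewrite mem_head.
- apply/IH/monomial_spanX; exists (\sum_(a <- ms) a)%MM; split; last exact: lepm_refl.
  by exists ms; split=> // b bms; apply: Lms; rewrite inE bms orbT.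
- by rewrite big_cons mpolyXD.
Qed.

Lemma sqfree_powP k f : sqfree_pow L k f <-> monomial_span (matching L k) f.
Proof.
split; (apply: ideal_gen_sub; first exact: ideal_gen_ideal).
  move=> _ [m [sqm /ideal_powP/monomial_spanX[b [[ms [sz Lms sum_ms]] bm]] ->]].
  apply/monomial_spanX; exists b; split=> //; exists ms; split=> //.
  exact: sqfree_le bm sqm.
move=> _ [m [ms [sz Lms sum_ms sqm]] ->]; apply: ideal_gen_mem; exists m; split=> //.
apply/ideal_powP/monomial_spanX; exists m; split; last exact: lepm_refl.
by exists ms.
Qed.

Lemma sqfree_powX k m : sqfree_pow L k 'X_[m] <-> exists a, matching L k a /\ (a <= m)%MM.
Proof. by rewrite sqfree_powP monomial_spanX. Qed.

Lemma sqfree_pow_ideal k : is_ideal (sqfree_pow L k).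
Proof. exact: ideal_gen_ideal. Qed.

Lemma sqfree_pow_supp k f :
  sqfree_pow L k f <-> forall m, m \in msupp f -> sqfree_pow L k 'X_[m].
Proof.
rewrite sqfree_powP monomial_span_supp.
by split=> H m /H; rewrite sqfree_powP.
Qed.

Lemma sqfree_pow0 f : sqfree_pow L 0 f.
Proof.
apply/sqfree_pow_supp => m _; apply/sqfree_powX; exists 0%MM; split.
  by exists [::]; rewrite big_nil; split=> // i; rewrite mnm0E.
by apply/mnm_lepP => i; rewrite mnm0E.
Qed.

(** Drop one factor of the product.  The factor is not 1, so it contains a
    variable, which the remaining product does not need. *)
Lemma matching_step k m : matching L k.+1 m ->
  exists m' i, [/\ matching L k m', (0 < m i)%N & (m' <= m - U_(i))%MM].
Proof.
case=> -[|a ms] [//= [sz] Lms]; rewrite big_cons => <- sq.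
have [|i ai] := @mnm_neq0 _ a; first by apply: sqfree_neq0; apply: Lms; rewrite mem_head.
exists (\sum_(a <- ms) a)%MM, i; split.
- exists ms; split=> // [b bms|]; first by apply: Lms; rewrite inE bms orbT.
  by apply: sqfree_le sq; apply: lem_addl.
- by rewrite mnmDE ltn_addr.
- apply/mnm_lepP => j; rewrite mnmBE mnmDE mnm1E; case: eqVneq => [<-|_] /=; lia.
Qed.

(** This is the inclusion of a squarefree power in the irrelevant ideal times the
    previous one. *)
Lemma sqfree_pow_step k m : sqfree_pow L k.+1 'X_[m] ->
  exists i, (0 < m i)%N /\ sqfree_pow L k 'X_[m - U_(i)].
Proof.
case/sqfree_powX=> b [/matching_step[m' [i [mat bi m'b]]] bm].
have mi : (0 < m i)%N by move/mnm_lepP: bm => /(_ i); apply: leq_trans.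
exists i; split=> //; apply/sqfree_powX; exists m'; split=> //.
apply: lepm_trans m'b _; apply/mnm_lepP => j; rewrite !mnmBE.
by move/mnm_lepP: bm => /(_ j); apply: leq_sub2r.
Qed.

Lemma sqfree_pow_irrelevant k f : sqfree_pow L k.+1 f -> irrelevant f.
Proof.
move=> Lf; apply/eqP; rewrite mcoeff_eq0; apply/negP => m0.
have [i []] := sqfree_pow_step ((sqfree_pow_supp _ _).1 Lf _ m0).
by rewrite mnm0E.
Qed.

Lemma sqfree_pow_sub k f : sqfree_pow L k.+1 f -> sqfree_pow L k f.
Proof.
rewrite !sqfree_pow_supp => H m /H/sqfree_pow_step[i [mi]].
by apply: ideal_lem (lem_subr _ _); apply: sqfree_pow_ideal.
Qed.

Lemma mdisjoint_sum_sqfree ms :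
  (forall a, a \in ms -> sqfree_mon a) -> pairwise mdisjoint ms ->
  sqfree_mon (\sum_(a <- ms) a)%MM.
Proof.
move=> sq disj i; elim: ms sq disj => [|a ms IH] sq /=; first by rewrite big_nil mnm0E.
case/andP=> /allP a_ms disj; rewrite big_cons mnmDE.
have {}IH : ((\sum_(b <- ms) b)%MM i <= 1)%N.
  by apply: IH disj => b bms; apply: sq; rewrite inE bms orbT.
have : (a i <= 1)%N by apply: sq; rewrite mem_head.
case: (posnP (a i)) => [-> _|ai a1]; first by rewrite add0n.
rewrite mnm_sumE big_seq big1 ?addn0 // => b /a_ms/forallP/(_ i).
by rewrite gtn_eqF //= => /eqP.
Qed.

Lemma sum_sqfree_mdisjoint ms :
  sqfree_mon (\sum_(a <- ms) a)%MM -> pairwise mdisjoint ms.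
Proof.
elim: ms => //= a ms IH; rewrite big_cons => sq; apply/andP; split; last first.
  by apply: IH; apply: sqfree_le sq; apply: lem_addl.
apply/allP => b bms; apply/forallP => i; have := sq i; rewrite mnmDE mnm_sumE.
by rewrite (big_rem b) //=; lia.
Qed.

(** A regular sequence of monomials has disjoint supports, and conversely; so the
    grade is the largest k with a nonzero k-th squarefree power. *)
Lemma monomial_gradeP k : (k <= monomial_grade L)%N <-> exists m, matching L k m.
Proof.
have reg v : (exists ms : seq 'X_{1..n}, let s := [seq 'X_[m] | m <- ms] in
    [/\ size ms = v, forall f, f \in s -> L f & regular_seq (fun f : T => f = 0) s]) <->
    exists m, matching L v m.
  split=> [[ms [sz Lms /regular_monomials[_ disj]]]|[m [ms [sz Lms <- sq]]]]; last first.
    exists ms; split=> // [_ /mapP[a /Lms La -> //]|]; apply/regular_monomials.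
    split; last exact: sum_sqfree_mdisjoint.
    by apply/negP => /Lms/sqfree_neq0; rewrite eqxx.
  have {sz} [rs [sz [Lrs disjr]]] : exists rs, size rs = v /\
      (forall a, a \in rs -> L 'X_[a] /\ sqfree_mon a) /\ pairwise mdisjoint rs.
    have {}Lms a : a \in ms -> L 'X_[a] by move=> ams; apply: Lms; apply: map_f.
    suff [rs [szr Lrs disjr _]] : exists rs, [/\ size rs = size ms,
        forall a, a \in rs -> L 'X_[a] /\ sqfree_mon a, pairwise mdisjoint rs &
        forall a, a \in rs -> exists2 b, b \in ms & (a <= b)%MM].
      by exists rs; rewrite szr.
    elim: ms disj Lms {sz} => [|b ms IH] /=; first by exists [::].
    case/andP=> /allP b_ms disj Lms; have [||rs [szr Lrs disjr le_rs]] := IH => //.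
      by move=> a ams; apply: Lms; rewrite inE ams orbT.
    have [|a [sqa La ab]] := @sqfree_root b; first by apply: Lms; rewrite mem_head.
    exists (a :: rs); split=> /=.
    - by rewrite szr.
    - by move=> c; rewrite inE => /predU1P[->|/Lrs].
    - rewrite disjr andbT; apply/allP => c /le_rs[d /b_ms/forallP bd cd].
      apply/forallP => i; have := bd i.
      move/mnm_lepP: ab => /(_ i); move/mnm_lepP: cd => /(_ i); lia.
    - move=> c; rewrite inE => /predU1P[->|/le_rs[d dms cd]].
        by exists b; rewrite ?mem_head.
      by exists d; rewrite // inE dms orbT.
  exists (\sum_(a <- rs) a)%MM, rs; split=> // [a /Lrs[] //|].
  by apply: mdisjoint_sum_sqfree => // a /Lrs[].
rewrite -reg; symmetry; apply: (@nat_max_le _ n).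
- move=> r s rs /reg[m mat]; apply/reg; move: rs m mat => /subnK<-.
  elim: (s - r)%N => [|d IH] m mat; first by exists m.
  by have [m' [i [/IH]]] := matching_step mat.
- apply/reg; exists 0%MM, [::]; rewrite big_nil; split=> // i.
  by rewrite mnm0E.
- move=> r /reg[m [ms [<- Lms sum_ms sq]]].
  have mn : (mdeg m <= n)%N.
    rewrite mdegE -[leqRHS]card_ord -sum1_card; apply: leq_sum => i _; exact: sq.
  apply: leq_trans mn; rewrite -sum_ms mdeg_sum -sum1_size big_seq [leqRHS]big_seq.
  by apply: leq_sum => a /Lms/sqfree_neq0; rewrite lt0n mdeg_eq0.
Qed.

Lemma sqfree_pow_nonzero k : (k <= monomial_grade L)%N -> exists m, sqfree_pow L k 'X_[m].
Proof.
case/monomial_gradeP => m mat; exists m; apply/sqfree_powX.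
by exists m; rewrite lepm_refl.
Qed.

Lemma monomial_grade_gt0 : (0 < monomial_grade L)%N.
Proof.
have [_ [f Lf f0] _] := sqfreeL.
have [a [sqa La _]] := sqfree_root (sqfree_supp Lf (mlead_supp f0)).
apply/monomial_gradeP; exists a, [:: a]; rewrite big_seq1; split=> // b.
by rewrite inE => /eqP->.
Qed.

End SquarefreePowers.

Section InitialDegree.
Variables (K : fieldType) (n : nat) (L : {mpoly K[n]} -> Prop).

(** A monomial of least degree in L is a minimal generator. *)
Lemma indegP : (exists m, L 'X_[m]) ->
  (exists m, L 'X_[m] /\ mdeg m = indeg L) /\ forall m, L 'X_[m] -> (indeg L <= mdeg m)%N.
Proof.
case=> m0 Lm0.
have [m [Lm minm]] : exists m, L 'X_[m] /\ forall m', L 'X_[m'] -> (mdeg m <= mdeg m')%N.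
  have [d] := ubnP (mdeg m0); elim: d m0 Lm0 => // d IH m0 Lm0 m0d.
  case: (classic (exists m', L 'X_[m'] /\ (mdeg m' < mdeg m0)%N)) => [[m' [Lm' lt]]|H].
    by apply: (IH m' Lm'); apply: leq_trans lt _.
  exists m0; split=> // m' Lm'; rewrite leqNgt; apply/negP => lt.
  by apply: H; exists m'.
have mingen : min_generator L m.
  split=> // m' Lm' le; have /(congr1 mdeg) := submK le.
  rewrite mdegD => deg_m; have : mdeg (m - m') = 0%N by have := minm _ Lm'; lia.
  by move/eqP; rewrite mdeg_eq0 => /eqP mm'; rewrite -[RHS](submK le) mm' add0m.
have : exists v, (exists2 m, min_generator L m & mdeg m = v) /\
    forall w, (exists2 m, min_generator L m & mdeg m = w) -> (v <= w)%N.
  by exists (mdeg m); split; [exists m | move=> _ [m' [/minm H _] <-]].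
move=> /(epsilon_spec (inhabits 0%N)); rewrite -/(nat_min _) -/(indeg L).
case=> [[m1 [Lm1 _] def_d] min1]; split; first by exists m1.
move=> m' /minm; apply: leq_trans; apply: min1; by exists m.
Qed.

End InitialDegree.

(** * Squarefree powers of (I, x) *)

Section AdjoinVariable.
Variables (K : fieldType) (n : nat) (I : {mpoly K[n]} -> Prop).
Hypothesis sqfreeI : sqfree_monomial_ideal I.
Local Notation J := (adjoin_var I).
Local Notation widen := (widen_ord (leqnSn _)).
Implicit Types (m : 'X_{1..n}) (M : 'X_{1..n.+1}).

Lemma mnm_lep_split M1 M2 : (M1 <= M2)%MM =
  (mnm_restr M1 <= mnm_restr M2)%MM && (M1 ord_max <= M2 ord_max)%N.
Proof.
apply/mnm_lepP/andP => [le|[/mnm_lepP le le_max] i].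
  by split; [apply/mnm_lepP => i; rewrite !mnmE | ].
by have [->|[j ->]] := ord_max_or_widen i; last by have := le j; rewrite !mnmE.
Qed.

Lemma mnm_restrD M1 M2 : mnm_restr (M1 + M2) = (mnm_restr M1 + mnm_restr M2)%MM.
Proof. by apply/mnmP => i; rewrite mnmDE !mnmE. Qed.

Lemma mnm_restr_sum (s : seq 'X_{1..n.+1}) :
  mnm_restr (\sum_(M <- s) M) = (\sum_(M <- s) mnm_restr M)%MM.
Proof.
elim: s => [|M s IH]; first by rewrite !big_nil; apply/mnmP => i; rewrite !mnmE.
by rewrite !big_cons mnm_restrD IH.
Qed.

Lemma mdeg_restr M : mdeg M = (mdeg (mnm_restr M) + M ord_max)%N.
Proof.
rewrite !mdegE big_ord_recr /=; congr (_ + _)%N.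
by apply: eq_bigr => i _; rewrite mnmE.
Qed.

Lemma mnm_ext0 m : mnm_ext m 0 = mnmwiden m.
Proof. by rewrite /mnm_ext mulm0n addm0. Qed.

Lemma adjoin_varX M : J 'X_[M] <-> (0 < M ord_max)%N \/ I 'X_[mnm_restr M].
Proof.
have [[A [_ IA]] _ _] := sqfreeI.
pose L (f : {mpoly K[n.+1]}) := forall M, M \in msupp f -> (0 < M ord_max)%N \/ I 'X_[mnm_restr M].
have idI := sqfree_ideal sqfreeI.
have idL : is_ideal L.
  split=> [M'|f g Lf Lg M'|f g Lg M']; first by rewrite msupp0.
    by move/msuppD_le; rewrite mem_cat => /orP[/Lf|/Lg].
  case/msuppM_le/allpairsP=> -[m1 m2] /= [_ /Lg H ->].
  rewrite mnmDE mnm_restrD; case: H => [H|H]; first by left; lia.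
  by right; apply: ideal_lem H; rewrite ?lem_addl.
have idJ : is_ideal J by apply: ideal_gen_ideal.
have JX : J 'X_ord_max by apply: ideal_gen_mem; right.
split=> [|[Mmax|IM]].
- suff : forall f, J f -> L f by move=> H /H; apply; rewrite msuppX mem_head.
  apply: ideal_gen_sub => // _ [[g Ig ->]|->] M'.
    rewrite mcoeff_msupp -(mnm_restrK M') -muni_coef muni_mwiden coefC.
    case: (M' ord_max) => [|t]; last by rewrite mcoeff0 eqxx.
    rewrite -mcoeff_msupp mnm_ext_max mnm_extK => /(sqfree_supp sqfreeI Ig).
    by right.
  by rewrite msuppX inE => /eqP->; left; rewrite mnm1E eqxx.
- apply: ideal_lem JX => //; apply/mnm_lepP => i; rewrite mnm1E.
  by case: eqVneq => // <-.
- have JI : J 'X_[mnmwiden (mnm_restr M)].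
    by apply: ideal_gen_mem; left; exists 'X_[mnm_restr M]; rewrite ?mwidenX.
  apply: ideal_lem JI => //; rewrite -mnm_ext0 mnm_lep_split mnm_extK lepm_refl.
  by rewrite mnm_ext_max.
Qed.

Lemma adjoin_var_sqfree : sqfree_monomial_ideal J.
Proof.
have [[A [sqA IA]] _ nI1] := sqfreeI.
pose AJ M := M = U_(ord_max)%MM \/ exists2 a, A a & M = mnmwiden a.
split; last first.
- rewrite -mpolyX0 adjoin_varX mnm0E => -[//|]; rewrite (_ : mnm_restr 0 = 0%MM).
    by rewrite mpolyX0.
  by apply/mnmP => i; rewrite !mnmE.
- exists 'X_ord_max; last by rewrite -msupp_eq0 msuppX.
  by apply/adjoin_varX; left; rewrite mnm1E eqxx.
exists AJ; split=> [M [->|[a /sqA sqa ->]] i|f].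
- by rewrite mnm1E; case: eqP.
- by have [->|[j ->]] := ord_max_or_widen i; rewrite ?mnmwiden_ordmax ?mnmwiden_widen.
split; apply: ideal_gen_sub; try exact: ideal_gen_ideal.
  move=> _ [[g /IA Ig ->]|->]; last first.
    by apply: ideal_gen_mem; exists U_(ord_max)%MM; [left|].
  pose P (g : {mpoly K[n]}) := monomial_span AJ (mwiden g).
  have idP : is_ideal P.
    have idAJ := ideal_gen_ideal (fun g : {mpoly K[n.+1]} => exists2 M, AJ M & g = 'X_[M]).
    split=> [|g1 g2|a g1]; rewrite /P ?mwiden0 ?mwidenD ?mwidenM.
    - exact: (ideal0 idAJ).
    - exact: (idealD idAJ).
    - exact: (idealM idAJ).
  apply: (ideal_gen_sub idP _ Ig) => _ [a Aa ->]; rewrite /P mwidenX.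
  by apply: ideal_gen_mem; exists (mnmwiden a) => //; right; exists a.
move=> _ [_ [->|[a Aa ->]] ->]; apply/adjoin_varX.
  by left; rewrite mnm1E eqxx.
right; rewrite -mnm_ext0 mnm_extK; apply/IA/ideal_gen_mem.
by exists a.
Qed.

Lemma matching_widen k m t : matching I k m -> (t <= 1)%N ->
  matching J (k + t) (mnm_ext m t).
Proof.
case=> ms [sz Ims sum_ms sqm] t1; exists (map (@mnmwiden n) ms ++ nseq t U_(ord_max)%MM).
split.
- by rewrite size_cat size_map size_nseq sz.
- move=> a; rewrite mem_cat => /orP[/mapP[b bms ->]|].
    by apply/adjoin_varX; right; rewrite -mnm_ext0 mnm_extK; apply: Ims.
  rewrite mem_nseq => /andP[_ /eqP->]; apply/adjoin_varX; left.
  by rewrite mnm1E eqxx.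
- rewrite big_cat big_map /= -mnmwiden_sum sum_ms /mnm_ext; congr (_ + _)%MM.
  by case: t t1 => [|[|//]] _; rewrite ?big_nil ?big_seq1.
- by move=> i; have [->|[j ->]] := ord_max_or_widen i; rewrite ?mnm_ext_max ?mnm_extE.
Qed.

(** At most one of the factors contains the last variable, since their product is
    squarefree; the others are monomials of I. *)
Lemma matching_restr k M : matching J k M ->
  (M ord_max = 0%N /\ matching I k (mnm_restr M)) \/
  (M ord_max = 1%N /\ exists m, matching I k.-1 m /\ (m <= mnm_restr M)%MM).
Proof.
case=> ms [<- Jms <- sq].
have restr (s : seq 'X_{1..n.+1}) : {subset s <= ms} -> (\sum_(a <- s) a)%MM ord_max = 0%N ->
    sqfree_mon (\sum_(a <- s) a)%MM -> matching I (size s) (mnm_restr (\sum_(a <- s) a)%MM).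
  move=> sms s0 sqs; exists (map (@mnm_restr n) s); split.
  - by rewrite size_map.
  - move=> _ /mapP[a a_s ->]; have /sms/Jms/adjoin_varX[a0|//] := a_s.
    by move/eqP: s0; rewrite mnm_sumE (big_rem a) //= addn_eq0 gtn_eqF.
  - by rewrite big_map mnm_restr_sum.
  - by move=> i; rewrite mnmE; apply: sqs.
have := sq ord_max; rewrite leq_eqVlt ltnS leqn0 => /orP[/eqP s1|/eqP s0]; last first.
  by left; split=> //; apply: restr.
right; split=> //; have [a ams a1] : exists2 a, a \in ms & (0 < a ord_max)%N.
  apply: NNPP => H; move: s1; rewrite mnm_sumE big_seq big1 // => a ams.
  by case: (posnP (a ord_max)) => // a1; case: H; exists a.
have sum_ms : (\sum_(b <- ms) b = a + \sum_(b <- rem a ms) b)%MM by rewrite (big_rem a).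
exists (mnm_restr (\sum_(b <- rem a ms) b)%MM); split; last first.
  by rewrite sum_ms mnm_restrD lem_addl.
rewrite -(size_rem ams); apply: restr => [b /mem_rem //||].
  by move: s1; rewrite sum_ms mnmDE; case: (a ord_max) a1 => [|[|?]] //= _ [].
by apply: sqfree_le sq; rewrite sum_ms lem_addl.
Qed.

Lemma sqfree_pow_adjoinX k M : sqfree_pow J k.+1 'X_[M] <->
  sqfree_pow I k.+1 'X_[mnm_restr M] \/
  ((0 < M ord_max)%N /\ sqfree_pow I k 'X_[mnm_restr M]).
Proof.
rewrite (sqfree_powX adjoin_var_sqfree) !(sqfree_powX sqfreeI); split.
  case=> M' [/matching_restr mat]; rewrite mnm_lep_split => /andP[le le_max].
  case: mat => [[_ mat]|[M1 [m [mat mM']]]]; first by left; exists (mnm_restr M').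
  right; split; first by rewrite -M1.
  by exists m; split=> //; apply: lepm_trans le.
case=> [[a [mat aM]]|[Mmax [a [mat aM]]]].
  exists (mnm_ext a 0); split; first by rewrite -[k.+1]addn0; apply: matching_widen.
  by rewrite mnm_lep_split mnm_extK mnm_ext_max aM.
exists (mnm_ext a 1); split; first by rewrite -[k.+1]addn1; apply: matching_widen.
by rewrite mnm_lep_split mnm_extK mnm_ext_max aM.
Qed.

(** Monomial by monomial, by [sqfree_pow_adjoinX]; on the right stands the ideal
    I^[k+1] + x I^[k]. *)
Lemma sqfree_pow_adjoin k f : sqfree_pow J k.+1 f <->
  poly_ideal (sqfree_pow I k.+1) (sqfree_pow I k) (muni f).
Proof.
rewrite (sqfree_pow_supp adjoin_var_sqfree); split=> [H|[H0 HS] M Mf].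
  split=> [|t]; apply/(sqfree_pow_supp sqfreeI) => m;
    rewrite mcoeff_msupp muni_coef -mcoeff_msupp => /H/sqfree_pow_adjoinX;
    rewrite mnm_extK mnm_ext_max.
  - by case=> [//|[]].
  - by case=> [/(sqfree_pow_sub sqfreeI) //|[]].
apply/sqfree_pow_adjoinX.
have : mnm_restr M \in msupp (muni f)`_(M ord_max).
  by rewrite mcoeff_msupp muni_coef mnm_restrK -mcoeff_msupp.
case: (M ord_max) => [|t] Msupp; first by left; apply: (sqfree_pow_supp sqfreeI _ _).1 Msupp.
by right; split=> //; apply: (sqfree_pow_supp sqfreeI _ _).1 Msupp.
Qed.

Lemma monomial_grade_adjoin : monomial_grade J = (monomial_grade I).+1.
Proof.
have grade k : (k.+1 <= monomial_grade J)%N = (k <= monomial_grade I)%N.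
  apply/idP/idP => [/(monomial_gradeP adjoin_var_sqfree)|/(monomial_gradeP sqfreeI)] H.
    apply/(monomial_gradeP sqfreeI).
    case: H => M /matching_restr[[_ mat]|[_ [m [mat _]]]]; last by exists m.
    by have [m [i [mat' _ _]]] := matching_step sqfreeI mat; exists m.
  apply/(monomial_gradeP adjoin_var_sqfree); case: H => m mat.
  by exists (mnm_ext m 1); rewrite -[k.+1]addn1; apply: matching_widen.
apply/eqP; rewrite eqn_leq grade leqnn andbT.
by case E: (monomial_grade J) => [|k] //; rewrite ltnS -grade E.
Qed.

(** Dropping a variable brings I^[k+1] into I^[k], so the least degree in J^[k+1]
    is attained on x I^[k]. *)
Lemma indeg_adjoin k : (k <= monomial_grade I)%N ->
  indeg (sqfree_pow J k.+1) = (indeg (sqfree_pow I k)).+1.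
Proof.
move=> /(sqfree_pow_nonzero sqfreeI) /indegP[[m [Im deg_m]] min_I].
have Jm : sqfree_pow J k.+1 'X_[mnm_ext m 1].
  by apply/sqfree_pow_adjoinX; right; rewrite mnm_extK mnm_ext_max.
have [|[M [JM deg_M]] min_J] := @indegP _ _ (sqfree_pow J k.+1); first by exists (mnm_ext m 1).
apply/eqP; rewrite eqn_leq; apply/andP; split.
  by apply: leq_trans (min_J _ Jm) _; rewrite mdeg_restr mnm_extK mnm_ext_max deg_m addn1.
rewrite -deg_M mdeg_restr; case/sqfree_pow_adjoinX: JM => [|[Mmax /min_I]]; last by lia.
case/(sqfree_pow_step sqfreeI) => i [mi /min_I].
have Ui : (U_(i) <= mnm_restr M)%MM.
  by apply/mnm_lepP => l; rewrite mnm1E; case: eqVneq => // <-.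
have /(congr1 mdeg) := submK Ui; rewrite mdegD mdeg1; lia.
Qed.

Lemma indeg_sqfree_pow0 : indeg (sqfree_pow I 0) = 0%N.
Proof.
have [|_ min_I] := @indegP _ _ (sqfree_pow I 0); first by exists 0%MM; apply: sqfree_pow0.
have := min_I 0%MM (sqfree_pow0 sqfreeI _); rewrite mdeg0 leqn0.
by move/eqP.
Qed.

End AdjoinVariable.

(** * Depth and initial degree of the squarefree powers of (I, x) *)

Section PositiveProjectiveDimension.
Variables (K : fieldType) (n : nat) (L : {mpoly K[n]} -> Prop).
Hypotheses (idL : is_ideal L) (Lirr : forall f, L f -> irrelevant f).
Hypothesis L_supp : forall f, L f -> forall m, m \in msupp f -> L 'X_[m].

(** A nonzero proper ideal L has H_1 (x; T/L) = L / m L, m the irrelevant ideal,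
    and a monomial of least degree in L is not in m L. *)
Lemma kvanish_ge2 p m0 : L 'X_[m0] -> kvanish (@mvar K n) n L p -> (2 <= p)%N.
Proof.
move=> Lm0; rewrite leqNgt ltnS => V; apply/negP => p1; move: V.
move=> /(kvanish_le p1) V.
have [|[m [Lm deg_m]] minL] := @indegP _ _ L; first by exists m0.
have [a def_m] := irrelevant_comb (Lirr Lm).
have [h [Hh Qh]] := koszul_homotopy (@mvar K n) n a.
have Dh : kD (@mvar K n) n *m (h *m kbot _ n) = 'X_[m] *: kbot _ n.
  rewrite def_m -[RHS]mul_scalar_mx -Hh mulmxDl -!mulmxA kD_bot mulmx0 add0r.
  by rewrite mulmxA.
(* The boundary of the cycle h bot modulo L is X^m in degree 0.  Were the cycle a
   boundary modulo L, X^m would be a combination of elements of L with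
   coefficients in the irrelevant ideal. *)
have [||w Hw] := V (h *m kbot _ n).
- by rewrite mulmxA Qh kQ0 mulmx1.
- by rewrite Dh => i j; rewrite mxE mulrC; apply: idealM.
have [i Hi] := kbot_entry {mpoly K[n]} n.
have : m \in msupp ((kD (@mvar K n) n *m (h *m kbot _ n - kD (@mvar K n) n *m w)) i 0).
  rewrite mulmxBr Dh mulmxA kD_sq mul0mx subr0 mxE Hi mulr1.
  by rewrite msuppX mem_head.
rewrite mxE => /msupp_sum_le/flatten_mapP[j _ /msuppM_le/allpairsP[[m1 m2] /= [Dm1 m2l def_mm]]].
have m1_neq0 : m1 != 0%MM.
  apply: contraTneq Dm1 => ->; rewrite mcoeff_msupp negbK; apply/eqP.
  apply: (kD_in (@irrelevant_ideal K n)) => v _; exact: mvar_irrelevant.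
have := minL m2 (L_supp (Hw j 0) m2l).
by rewrite -deg_m def_mm mdegD -{2}[mdeg m2]add0n leq_add2r leqn0 mdeg_eq0 (negPf m1_neq0).
Qed.

End PositiveProjectiveDimension.

Lemma sqfree_pow_vanish_ge2 (K : fieldType) (n : nat) (L : {mpoly K[n]} -> Prop) k p :
  sqfree_monomial_ideal L -> (k < monomial_grade L)%N ->
  kvanish (@mvar K n) n (sqfree_pow L k.+1) p -> (2 <= p)%N.
Proof.
move=> sqfreeL /(sqfree_pow_nonzero sqfreeL)[m Lm]; apply: (kvanish_ge2 _ _ _ Lm).
- exact: sqfree_pow_ideal.
- by move=> f; apply: sqfree_pow_irrelevant.
- by move=> f /(sqfree_pow_supp sqfreeL).
Qed.

Lemma eq_from_le a b : (forall r, (r <= a)%N <-> (r <= b)%N) -> a = b.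
Proof. by move=> ab; apply/eqP; rewrite eqn_leq; apply/andP; split; apply/ab. Qed.

Section DepthOfAdjoin.
Variables (K : fieldType) (n : nat) (I : {mpoly K[n]} -> Prop).
Hypothesis sqfreeI : sqfree_monomial_ideal I.
Hypothesis cwlI : forall k : nat, (1 <= k <= monomial_grade I)%N ->
  componentwise_linear (sqfree_pow I k).
Local Notation J := (adjoin_var I).
Local Notation vanish := (kvanish (@mvar K n) n).

(** The first squarefree power is compared with the whole ring, where every chain
    is allowed; the later ones with a componentwise linear ideal. *)
Lemma sqfree_pow_cycles k : (k <= monomial_grade I)%N ->
  forall z : 'cV_(kdim n), mx_in (sqfree_pow I k.+1) (kD (@mvar K n) n *m z) ->
  exists b, mx_in (sqfree_pow I k) b /\ kD (@mvar K n) n *m z = kD (@mvar K n) n *m b.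
Proof.
case: k => [|k] k_le z Lz.
  by exists z; split=> // i j; apply: sqfree_pow0.
apply: (componentwise_linear_cycles (sqfree_pow_ideal I k.+2) (sqfree_pow_ideal I k.+1)) Lz.
- by move=> f /(sqfree_pow_supp sqfreeI).
- by move=> m; apply: sqfree_pow_step.
- exact: cwlI.
Qed.

(** Transports the cone lemmas to the polynomial ring in n + 1 variables.  The
    inverse one starts in degree 2, which is where the homology of a nonzero
    proper ideal can begin to vanish. *)
Lemma depth_adjoinP k r : (k <= monomial_grade I)%N ->
  (r <= depth_quot (sqfree_pow J k.+1))%N <->
  [/\ (r <= n)%N, vanish (sqfree_pow I k.+1) (n.+1 - r)%N
    & vanish (sqfree_pow I k) (n.+2 - r)%N].
Proof.
move=> k_le; have sqfreeJ := adjoin_var_sqfree sqfreeI.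
pose y i := muni (mvar K n.+1 i).
have yx i : (i < n)%N -> y i = (mvar K n i)%:P.
  move=> i_n; rewrite /y -[i]/(val (Ordinal i_n)) mvar_ord -muni_mwiden mwidenX mnmwiden1.
  by rewrite -mvar_ord.
have yn : y n = 'X by rewrite /y -[n]/(val (@ord_max n)) mvar_ord muni_max.
have iso p : kvanish (@mvar K n.+1) n.+1 (sqfree_pow J k.+1) p <->
    kvanish y n.+1 (poly_ideal (sqfree_pow I k.+1) (sqfree_pow I k)) p.
  apply: (@kvanish_iso _ _ (@muni n K : {rmorphism _ -> _}) (@unmuni K n)).
  - exact: muniK.
  - exact: unmuniK.
  - by [].
  - exact: sqfree_pow_adjoin.
have id1 := sqfree_pow_ideal I k.+1; have id0 := sqfree_pow_ideal I k.
have sub := @sqfree_pow_sub _ _ _ sqfreeI k.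
rewrite (depth_quotP (sqfree_pow_ideal J _) (@sqfree_pow_irrelevant _ _ _ sqfreeJ k)) iso.
split=> [[r_le V]|[r_n V1 V0]].
  have k_lt : (k < monomial_grade J)%N by rewrite monomial_grade_adjoin.
  have := sqfree_pow_vanish_ge2 sqfreeJ k_lt ((iso _).2 V); rewrite leq_subRL // => r_n.
  have r_n' : (r <= n)%N by rewrite -ltnS -ltnS -addn2.
  move: V; rewrite subSn; last by apply: leqW.
  case/(kvanish_cone_inv yx yn id1 id0 sub (@koszul_exact_pos K n) (sqfree_pow_cycles k_le)).
    by rewrite subn_gt0.
  by rewrite -subSn //; apply: leqW.
split; first by rewrite (leq_trans r_n) // -addn2 leq_addr.
rewrite subSn; last exact: leqW.
apply: (kvanish_cone yx yn id1 id0 sub V1).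
by rewrite -subSn //; apply: leqW.
Qed.

Lemma depth_sqfree_powP k r : (r <= depth_quot (sqfree_pow I k.+1))%N <->
  (r <= n.+1)%N /\ vanish (sqfree_pow I k.+1) (n.+1 - r)%N.
Proof.
apply: depth_quotP; first exact: sqfree_pow_ideal.
by move=> f; apply: sqfree_pow_irrelevant.
Qed.

Lemma sqfree_pow_vanish_lt k r : (k < monomial_grade I)%N -> (r <= n.+1)%N ->
  vanish (sqfree_pow I k.+1) (n.+1 - r)%N -> (r < n)%N.
Proof.
move=> k_lt r_n /(sqfree_pow_vanish_ge2 sqfreeI k_lt).
by rewrite leq_subRL // addn2 !ltnS.
Qed.

Lemma depth_adjoin_first : depth_quot (sqfree_pow J 1) = depth_quot (sqfree_pow I 1).
Proof.
apply: eq_from_le => r; rewrite depth_adjoinP // depth_sqfree_powP.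
split=> [[r_n V1 _]|[r_n V1]]; first by split=> //; apply: leqW.
split=> //; first exact/ltnW/(sqfree_pow_vanish_lt (monomial_grade_gt0 sqfreeI)).
by move=> z _ _; exists 0 => i j; apply: sqfree_pow0.
Qed.

Lemma vanish_depth k r : (r <= n)%N ->
  vanish (sqfree_pow I k.+1) (n.+2 - r)%N <-> (r <= (depth_quot (sqfree_pow I k.+1)).+1)%N.
Proof.
case: r => [|r] r_n.
  by split=> // _; apply: kvanish_gt; [apply: sqfree_pow_ideal | rewrite subn0].
rewrite ltnS subSS depth_sqfree_powP.
by split=> [V|[_ V]] //; split=> //; rewrite leqW // ltnW.
Qed.

Lemma depth_adjoin_mid k : (k.+1 < monomial_grade I)%N ->
  depth_quot (sqfree_pow J k.+2) =
    minn (depth_quot (sqfree_pow I k.+2)) (depth_quot (sqfree_pow I k.+1)).+1.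
Proof.
move=> k_lt; apply: eq_from_le => r; rewrite depth_adjoinP; last exact: ltnW.
rewrite leq_min; split=> [[r_n V1 V0]|/andP[/depth_sqfree_powP[r_n V1] r_d]].
  apply/andP; split; last by apply/vanish_depth.
  by apply/depth_sqfree_powP; split=> //; apply: leqW.
have r_lt := sqfree_pow_vanish_lt k_lt r_n V1.
by split=> //; [apply: ltnW | apply/vanish_depth => //; apply: ltnW].
Qed.

(** Here L1 = 0, whose condition is the exactness of the Koszul complex. *)
Lemma depth_adjoin_last k : monomial_grade I = k.+1 ->
  depth_quot (sqfree_pow J k.+2) = (depth_quot (sqfree_pow I k.+1)).+1.
Proof.
move=> gradeI; apply: eq_from_le => r; rewrite depth_adjoinP ?gradeI //.
have zero f : f = 0 <-> sqfree_pow I k.+2 f.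
  split=> [->|If]; first exact: (ideal0 (sqfree_pow_ideal _ _)).
  apply/eqP; rewrite -msupp_eq0; case E: (msupp f) => [//|m s].
  have : sqfree_pow I k.+2 'X_[m].
    by apply: (sqfree_pow_supp sqfreeI _ _).1 If _ _; rewrite E mem_head.
  case/(sqfree_powX sqfreeI) => a [mat _].
  have : (k.+2 <= monomial_grade I)%N by apply/(monomial_gradeP sqfreeI); exists a.
  by rewrite gradeI ltnn.
split=> [[r_n _ V0]|r_d]; first exact/vanish_depth.
have r_n : (r <= n)%N.
  case: r r_d => // r; rewrite ltnS => /depth_sqfree_powP[r_n V].
  by apply: sqfree_pow_vanish_lt V => //; rewrite gradeI.
split=> //; last exact/vanish_depth.
apply: (kvanish_ext zero); apply: kvanish_le (@koszul_exact_pos K n).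
by rewrite subn_gt0 ltnS.
Qed.

End DepthOfAdjoin.

(* At k = nu(I) + 1 the first term of the minimum is +oo, because norm_depth I k
   is. *)
Theorem proposition2p4 (K : fieldType) (n : nat) (I : {mpoly K[n]} -> Prop)
    (sqfreeI : sqfree_monomial_ideal I)
    (cwlI : forall k : nat, (1 <= k <= monomial_grade I)%N ->
       componentwise_linear (sqfree_pow I k)) :
  monomial_grade (adjoin_var I) = (monomial_grade I).+1 /\
  forall k : nat, (1 <= k <= monomial_grade (adjoin_var I))%N ->
    norm_depth (adjoin_var I) k =
      Order.min
        (adde (norm_depth I k)
           (EFin (indeg_pow I k - indeg_pow I k.-1 - 1)))
        (norm_depth I k.-1).
Proof.
have gradeJ := monomial_grade_adjoin sqfreeI; split=> // -[//|k] k_le.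
have k_le' : (k <= monomial_grade I)%N by rewrite gradeJ in k_le.
rewrite /norm_depth k_le (indeg_adjoin sqfreeI k_le') /=.
case: k k_le k_le' => [|k] k_le k_le' /=.
  rewrite (monomial_grade_gt0 sqfreeI) (depth_adjoin_first sqfreeI cwlI).
  rewrite (indeg_sqfree_pow0 sqfreeI).
  rewrite min_l ?leey //; congr EFin; lia.
rewrite k_le'; case: ltnP => [k_lt|le_k].
  rewrite (depth_adjoin_mid sqfreeI cwlI k_lt).
  have add_fin (a b : int) : adde (EFin a) (EFin b) = EFin (a + b) by [].
  have min_fin (a b : int) : Order.min (EFin a) (EFin b) = EFin (Order.min a b).
    by rewrite !minEle lee_fin; case: ifP.
  by rewrite add_fin min_fin; congr EFin; lia.
have gradeI : monomial_grade I = k.+1 by apply/eqP; rewrite eqn_leq le_k.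
rewrite (depth_adjoin_last sqfreeI cwlI gradeI) min_r ?leey //; congr EFin; lia.
Qed.
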